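(* Every infinite planar $2$-group is abelian.
   Context: A $2$-group is a group in which every element has order a power of $2$. For a group $G$, the subgroup graph $\mathcal{L}(G)$ is the graph whose vertices are all subgroups of $G$, two subgroups $H,K$ being adjacent if one of them is a maximal subgroup of the other. $G$ is planar if $\mathcal{L}(G)$ is a planar graph. *)

(* Defs.v *)
From Stdlib Require Import Reals List Arith.
Open Scope R_scope.

Record Group := {
  carrier :> Type;
  gmul : carrier -> carrier -> carrier;
  gone : carrier;
  ginv : carrier -> carrier;
  gmulA : forall x y z, gmul x (gmul y z) = gmul (gmul x y) z;
  gmul1l : forall x, gmul gone x = x;
  gmul1r : forall x, gmul x gone = x;
  gmulVl : forall x, gmul (ginv x) x = gone;
  gmulVr : forall x, gmul x (ginv x) = gone
}.

Fixpoint gpow (G : Group) (x : G) (n : nat) : G :=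
  match n with
  | O => gone G
  | S m => gmul G x (gpow G x m)
  end.

Definition has_order (G : Group) (x : G) (m : nat) : Prop :=
  (0 < m)%nat /\ gpow G x m = gone G /\
  forall j, (0 < j < m)%nat -> gpow G x j <> gone G.

Definition two_group (G : Group) : Prop :=
  forall x : G, exists k : nat, has_order G x (2 ^ k).

Definition infinite_group (G : Group) : Prop :=
  ~ exists l : list G, forall x : G, In x l.

Definition abelian (G : Group) : Prop :=
  forall x y : G, gmul G x y = gmul G y x.

Definition is_subgroup (G : Group) (H : G -> Prop) : Prop :=
  H (gone G) /\ (forall x y, H x -> H y -> H (gmul G x y)) /\
  (forall x, H x -> H (ginv G x)).

Definition subgroup (G : Group) := { H : G -> Prop | is_subgroup G H }.

Definition sgset {G : Group} (H : subgroup G) : G -> Prop := proj1_sig H.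

Definition maximal_in {G : Group} (H K : subgroup G) : Prop :=
  (forall x, sgset H x -> sgset K x) /\
  (exists x, sgset K x /\ ~ sgset H x) /\
  (forall L : subgroup G,
     (forall x, sgset H x -> sgset L x) -> (forall x, sgset L x -> sgset K x) ->
     (forall x, sgset L x <-> sgset H x) \/ (forall x, sgset L x <-> sgset K x)).

Definition sg_adj {G : Group} (H K : subgroup G) : Prop :=
  maximal_in H K \/ maximal_in K H.

Definition path_continuous (g : R -> R * R) : Prop :=
  forall t, 0 <= t <= 1 -> forall eps, 0 < eps -> exists delta, 0 < delta /\
    forall s, 0 <= s <= 1 -> Rabs (s - t) < delta ->
      Rabs (fst (g s) - fst (g t)) < eps /\ Rabs (snd (g s) - snd (g t)) < eps.

Definition planar_graph (V : Type) (adj : V -> V -> Prop) : Prop :=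
  exists (f : V -> R * R) (arc : V -> V -> R -> R * R),
    (forall u v, f u = f v -> u = v) /\
    (forall u v, adj u v ->
       path_continuous (arc u v) /\
       (forall s t, 0 <= s <= 1 -> 0 <= t <= 1 -> arc u v s = arc u v t -> s = t) /\
       arc u v 0 = f u /\ arc u v 1 = f v /\
       (forall s w, 0 < s < 1 -> arc u v s <> f w)) /\
    (forall u v u' v', adj u v -> adj u' v' ->
       ~ ((u = u' /\ v = v') \/ (u = v' /\ v = u')) ->
       forall s t, 0 <= s <= 1 -> 0 <= t <= 1 -> arc u v s = arc u' v' t ->
         (s = 0 \/ s = 1) /\ (t = 0 \/ t = 1)).

Definition planar_group (G : Group) : Prop :=
  planar_graph (subgroup G) (@sg_adj G).

(* Main.v *)
Require Import Defs.
From Stdlib Require Import Reals Lra Lia List Bool Ring Arith.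
From Stdlib Require Import ClassicalEpsilon Classical.
From Coquelicot Require Import Compactness.
From Stdlib Require Import FunctionalExtensionality PropExtensionality.
Import ListNotations.

(* A planar graph contains no subdivision of K33. To prove this for topological arcs,
   each arc is replaced by a polyline so close to it that the walks of non-adjacent
   edges stay disjoint (arcs sharing a vertex may cross). For disjoint segments ab and
   cd, the number of endpoints of cd vertically below ab plus the number of endpoints of
   ab vertically above cd is even; summing this over the 18 pairs of non-adjacent edges
   of K33 gives 0 = 1 mod 2.

   Consequently no section of a planar group G is elementary abelian of order 8, a
   product of two cyclic groups of order 4, or dihedral of order 16. Hence two
   involutions have a product of order at most 4. If a is an involution, the involutions
   commuting with a commute modulo a, so they are finitely many; as any two involutions
   commute or have a common commuting involution, G has finitely many involutions.
   Passing to C(a)/<a>, a planar 2-group has finitely many elements of each order, so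
   conjugacy classes are finite. If G is infinite and x, y do not commute, their common
   centralizer is therefore infinite and contains c of large order. As C4 x C4 is
   excluded, x c^i and y c^j are involutions for some i, j. They generate a dihedral
   group of order 8 whose center lies in <c>, and modulo this center they generate,
   together with the element of order 4 of <c>, an elementary abelian group of order 8:
   a contradiction. *)

(** Classical truth values turn counting modulo 2 into [xorb] sums, in which [ring] cancels equal
    terms. *)
Definition tv (P : Prop) : bool :=
  if excluded_middle_informative P then true else false.

Lemma tv_true (P : Prop) : P -> tv P = true.
Proof. unfold tv; destruct (excluded_middle_informative P); tauto. Qed.

Lemma tv_false (P : Prop) : ~ P -> tv P = false.
Proof. unfold tv; destruct (excluded_middle_informative P); tauto. Qed.

Lemma tv_iff (P Q : Prop) : (P <-> Q) -> tv P = tv Q.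
Proof.
  intros H; destruct (classic P).
  - rewrite !tv_true; tauto.
  - rewrite !tv_false; tauto.
Qed.

Lemma tv_not (P Q : Prop) : (P <-> ~ Q) -> tv P = negb (tv Q).
Proof.
  intros H; destruct (classic Q).
  - rewrite (tv_true Q), tv_false; tauto.
  - rewrite (tv_false Q), tv_true; tauto.
Qed.

(** * Parity of crossings of segments and polylines *)

Definition seg (a b p : R * R) : Prop :=
  exists t, 0 <= t <= 1 /\ fst p = fst a + t * (fst b - fst a) /\
            snd p = snd a + t * (snd b - snd a).

Definition seg_disjoint (a b c d : R * R) : Prop :=
  forall p, seg a b p -> seg c d p -> False.

Lemma seg_l (a b : R * R) : seg a b a.
Proof. exists 0; repeat split; lra. Qed.

Lemma seg_r (a b : R * R) : seg a b b.
Proof. exists 1; repeat split; lra. Qed.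

Lemma seg_rev (a b p : R * R) : seg a b p -> seg b a p.
Proof. intros (t & Ht & H1 & H2); exists (1 - t); repeat split; lra. Qed.

Lemma seg_convex (a b p q r : R * R) :
  seg a b p -> seg a b q -> seg p q r -> seg a b r.
Proof.
  intros (s & Hs & H1 & H2) (t & Ht & H3 & H4) (k & Hk & H5 & H6).
  exists (s + k * (t - s)); repeat split.
  - nra.
  - nra.
  - rewrite H5, H1, H3; ring.
  - rewrite H6, H2, H4; ring.
Qed.

Lemma seg_slice (a b : R * R) (x : R) :
  fst a <= x <= fst b -> exists y, seg a b (x, y).
Proof.
  intros H; destruct (Req_dec (fst a) (fst b)) as [E | E].
  - exists (snd a), 0; simpl; repeat split; lra.
  - exists (snd a + (x - fst a) / (fst b - fst a) * (snd b - snd a)).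
    exists ((x - fst a) / (fst b - fst a)); simpl.
    assert (H0 : 0 < fst b - fst a) by lra.
    repeat split.
    + apply Rmult_le_pos; [lra | left; apply Rinv_0_lt_compat; lra].
    + apply Rmult_le_reg_r with (1 := H0); field_simplify; lra.
    + field; lra.
Qed.

Lemma seg_slice_unique (a b : R * R) (x y y' : R) :
  fst a < fst b -> seg a b (x, y) -> seg a b (x, y') -> y = y'.
Proof.
  intros H (s & _ & H1 & H2) (t & _ & H3 & H4); simpl in *.
  assert (E : (s - t) * (fst b - fst a) = 0) by lra.
  apply Rmult_integral in E as [E | E]; [| lra].
  replace t with s in H4 by lra; lra.
Qed.

(** Between the abscissas [x] and [x'] the height difference of the two chords is affine and changes
    sign; [k] below is the parameter of its zero, where the segments meet. *)
Lemma seg_crossing (a b c d : R * R) (x x' y1 y2 y1' y2' : R) :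
  seg_disjoint a b c d ->
  seg a b (x, y1) -> seg c d (x, y2) -> seg a b (x', y1') -> seg c d (x', y2') ->
  y1 <= y2 -> y2' <= y1' -> False.
Proof.
  intros D S1 S2 S1' S2' H H'.
  destruct (Req_dec ((y2 - y1) + (y1' - y2')) 0) as [E | E].
  - apply (D (x, y1)); trivial. replace y1 with y2 by lra; trivial.
  - set (k := (y2 - y1) / ((y2 - y1) + (y1' - y2'))).
    assert (H0 : 0 < (y2 - y1) + (y1' - y2')) by lra.
    assert (Hk : 0 <= k <= 1).
    { unfold k; split.
      - apply Rmult_le_pos; [lra | left; apply Rinv_0_lt_compat; lra].
      - apply Rmult_le_reg_r with (1 := H0).
        unfold Rdiv; rewrite Rmult_assoc, Rinv_l; lra. }
    apply (D (x + k * (x' - x), y1 + k * (y1' - y1))).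
    + apply (seg_convex a b (x, y1) (x', y1')); trivial.
      exists k; simpl; auto.
    + apply (seg_convex c d (x, y2) (x', y2')); trivial.
      exists k; simpl; repeat split; try lra.
      unfold k; field; lra.
Qed.

(* A vertical ray from [v] is pushed slightly to the right of [v] in [under] and
   slightly to the left in [above]: the opposite half-open conventions make the
   two counts consistent in [crossing_parity] without any general position. *)
Definition under (a b v : R * R) : bool :=
  tv ((fst a <= fst v < fst b \/ fst b <= fst v < fst a) /\
      exists y, snd v < y /\ seg a b (fst v, y)).

Definition above (a b v : R * R) : bool :=
  tv ((fst a < fst v <= fst b \/ fst b < fst v <= fst a) /\
      exists y, y < snd v /\ seg a b (fst v, y)).

(** The upward ray from [v] pushed to the right and the downward ray pushed to the left join into
    one curve through [v]. This is the left side of that curve: on the vertical line of [v] it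
    contains the points above [v] and not those below. *)
Definition before (v p : R * R) : bool :=
  tv (fst p < fst v \/ fst p = fst v /\ snd v < snd p).

Lemma under_rev (a b v : R * R) : under a b v = under b a v.
Proof.
  apply tv_iff; split; intros [H (y & Hy & S)];
    (split; [tauto | exists y; split; [trivial | apply seg_rev; trivial]]).
Qed.

Lemma above_rev (a b v : R * R) : above a b v = above b a v.
Proof.
  apply tv_iff; split; intros [H (y & Hy & S)];
    (split; [tauto | exists y; split; [trivial | apply seg_rev; trivial]]).
Qed.

Lemma seg_disjoint_rev_l (a b c d : R * R) :
  seg_disjoint a b c d -> seg_disjoint b a c d.
Proof. intros D p H; apply D; apply seg_rev; trivial. Qed.

Lemma seg_disjoint_rev_r (a b c d : R * R) :
  seg_disjoint a b c d -> seg_disjoint a b d c.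
Proof. intros D p H H'; apply (D p); trivial; apply seg_rev; trivial. Qed.

Lemma surj_pt (p : R * R) : (fst p, snd p) = p.
Proof. destruct p; trivial. Qed.

(** The four cases are the relative positions of the projections to the horizontal axis. In each,
    two of the four terms vanish and the abscissa conditions of the other two coincide. These two
    are then equal, because disjoint segments keep their vertical order over the whole common range,
    by [seg_crossing]. *)
Lemma crossing_parity_sorted (a b c d : R * R) :
  fst a <= fst b -> fst c <= fst d -> seg_disjoint a b c d ->
  xorb (xorb (under a b c) (under a b d)) (xorb (above c d a) (above c d b)) = false.
Proof.
  intros Hab Hcd D.
  assert (Sa : seg a b (fst a, snd a)) by (rewrite surj_pt; apply seg_l).
  assert (Sb : seg a b (fst b, snd b)) by (rewrite surj_pt; apply seg_r).
  assert (Sc : seg c d (fst c, snd c)) by (rewrite surj_pt; apply seg_l).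
  assert (Sd : seg c d (fst d, snd d)) by (rewrite surj_pt; apply seg_r).
  destruct (Rle_lt_dec (fst a) (fst c)) as [H | H];
  destruct (Rle_lt_dec (fst b) (fst d)) as [H' | H'].
  - assert (E1 : under a b d = false) by (apply tv_false; lra).
    assert (E2 : above c d a = false) by (apply tv_false; lra).
    enough (E : under a b c = above c d b).
    { rewrite E1, E2, E; destruct (above c d b); reflexivity. }
    apply tv_iff; split; intros [K (y & Hy & S)]; (split; [lra |]).
    + destruct (seg_slice c d (fst b)) as [y' S']; [lra |].
      exists y'; split; trivial.
      apply Rnot_le_lt; intros Q.
      exact (seg_crossing a b c d _ _ _ _ _ _ D Sb S' S Sc Q (Rlt_le _ _ Hy)).
    + destruct (seg_slice a b (fst c)) as [y' S']; [lra |].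
      exists y'; split; trivial.
      apply Rnot_le_lt; intros Q.
      exact (seg_crossing a b c d _ _ _ _ _ _ D S' Sc Sb S Q (Rlt_le _ _ Hy)).
  - assert (E1 : above c d a = false) by (apply tv_false; lra).
    assert (E2 : above c d b = false) by (apply tv_false; lra).
    enough (E : under a b c = under a b d).
    { rewrite E1, E2, E; destruct (under a b d); reflexivity. }
    apply tv_iff; split; intros [K (y & Hy & S)]; (split; [lra |]).
    + destruct (seg_slice a b (fst d)) as [y' S']; [lra |].
      exists y'; split; trivial.
      apply Rnot_le_lt; intros Q.
      exact (seg_crossing a b c d _ _ _ _ _ _ D S' Sd S Sc Q (Rlt_le _ _ Hy)).
    + destruct (seg_slice a b (fst c)) as [y' S']; [lra |].
      exists y'; split; trivial.
      apply Rnot_le_lt; intros Q.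
      exact (seg_crossing a b c d _ _ _ _ _ _ D S' Sc S Sd Q (Rlt_le _ _ Hy)).
  - assert (E1 : under a b c = false) by (apply tv_false; lra).
    assert (E2 : under a b d = false) by (apply tv_false; lra).
    enough (E : above c d a = above c d b).
    { rewrite E1, E2, E; destruct (above c d b); reflexivity. }
    apply tv_iff; split; intros [K (y & Hy & S)]; (split; [lra |]).
    + destruct (seg_slice c d (fst b)) as [y' S']; [lra |].
      exists y'; split; trivial.
      apply Rnot_le_lt; intros Q.
      exact (seg_crossing a b c d _ _ _ _ _ _ D Sb S' Sa S Q (Rlt_le _ _ Hy)).
    + destruct (seg_slice c d (fst a)) as [y' S']; [lra |].
      exists y'; split; trivial.
      apply Rnot_le_lt; intros Q.
      exact (seg_crossing a b c d _ _ _ _ _ _ D Sa S' Sb S Q (Rlt_le _ _ Hy)).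
  - assert (E1 : under a b c = false) by (apply tv_false; lra).
    assert (E2 : above c d b = false) by (apply tv_false; lra).
    enough (E : under a b d = above c d a).
    { rewrite E1, E2, E; destruct (above c d a); reflexivity. }
    apply tv_iff; split; intros [K (y & Hy & S)]; (split; [lra |]).
    + destruct (seg_slice c d (fst a)) as [y' S']; [lra |].
      exists y'; split; trivial.
      apply Rnot_le_lt; intros Q.
      exact (seg_crossing a b c d _ _ _ _ _ _ D Sa S' S Sd Q (Rlt_le _ _ Hy)).
    + destruct (seg_slice a b (fst d)) as [y' S']; [lra |].
      exists y'; split; trivial.
      apply Rnot_le_lt; intros Q.
      exact (seg_crossing a b c d _ _ _ _ _ _ D S' Sd Sa S Q (Rlt_le _ _ Hy)).
Qed.

Lemma crossing_parity (a b c d : R * R) :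
  seg_disjoint a b c d ->
  xorb (xorb (under a b c) (under a b d)) (xorb (above c d a) (above c d b)) = false.
Proof.
  assert (W : forall a b c d, fst a <= fst b -> seg_disjoint a b c d ->
    xorb (xorb (under a b c) (under a b d)) (xorb (above c d a) (above c d b)) = false).
  { clear; intros a b c d H D.
    destruct (Rle_lt_dec (fst c) (fst d)) as [K | K].
    - apply crossing_parity_sorted; trivial.
    - rewrite (xorb_comm (under a b c)), !(above_rev c d).
      apply crossing_parity_sorted; [trivial | lra | apply seg_disjoint_rev_r; trivial]. }
  intros D; destruct (Rle_lt_dec (fst a) (fst b)) as [K | K].
  - apply W; trivial.
  - rewrite (xorb_comm (above c d a)), !(under_rev a b).
    apply W; [lra | apply seg_disjoint_rev_l; trivial].
Qed.

(** A segment missing [v] crosses the curve described at [before] exactly when its ends lie on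
    different sides; [under] counts crossings with the upper half of the curve and [above] those
    with the lower half. *)
Lemma vertical_parity_sorted (p q v : R * R) :
  fst p <= fst q -> ~ seg p q v ->
  xorb (under p q v) (above p q v) = xorb (before v p) (before v q).
Proof.
  intros H N.
  assert (Sp : seg p q (fst p, snd p)) by (rewrite surj_pt; apply seg_l).
  assert (Sq : seg p q (fst q, snd q)) by (rewrite surj_pt; apply seg_r).
  destruct (Rtotal_order (fst p) (fst v)) as [P | [P | P]];
  destruct (Rtotal_order (fst q) (fst v)) as [Q | [Q | Q]]; try lra.
  - unfold under, above, before.
    rewrite (tv_true (fst p < _ \/ _)), (tv_true (fst q < _ \/ _)), !tv_false by lra; trivial.
  - unfold under.
    rewrite (tv_false ((_ \/ _) /\ _)) by lra.
    replace (before v p) with true by (symmetry; apply tv_true; lra).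
    unfold above, before; apply tv_not; split.
    + intros [_ (y & Hy & S)] [K | K]; [lra |].
      rewrite <- Q in S.
      pose proof (seg_slice_unique p q _ _ _ ltac:(lra) S Sq); lra.
    + intros K; split; [lra |]; exists (snd q); split.
      * apply Rnot_le_lt; intros [L | L]; [tauto |].
        apply N; rewrite <- (surj_pt v), <- Q, L; trivial.
      * rewrite <- Q; trivial.
  - unfold before.
    rewrite (tv_true (fst p < _ \/ _)), (tv_false (fst q < _ \/ _)) by lra.
    enough (E : under p q v = negb (above p q v))
      by (rewrite E; destruct (above p q v); trivial).
    apply tv_not; split.
    + intros [_ (y & Hy & S)] [_ (y' & Hy' & S')].
      pose proof (seg_slice_unique p q _ _ _ ltac:(lra) S S'); lra.
    + intros K; split; [lra |].
      destruct (seg_slice p q (fst v)) as [y S]; [lra |].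
      exists y; split; trivial.
      destruct (Rtotal_order y (snd v)) as [L | [L | L]]; trivial; exfalso.
      * apply K; split; [lra | exists y; auto].
      * apply N; rewrite <- (surj_pt v), <- L; trivial.
  (* A segment on the vertical line of [v] is counted by neither term; since it misses [v], it lies
     wholly above or wholly below. *)
  - unfold under, above, before.
    rewrite !(tv_false ((_ \/ _) /\ _)) by lra; simpl.
    assert (E : tv (fst p < fst v \/ fst p = fst v /\ snd v < snd p) =
                tv (fst q < fst v \/ fst q = fst v /\ snd v < snd q)).
    { assert (W : forall p q : R * R, fst p = fst v -> fst q = fst v -> ~ seg p q v ->
         snd v < snd p -> snd v < snd q).
      { clear; intros p q P Q N L; apply Rnot_le_lt; intros K; apply N.
        assert (H0 : 0 < snd p - snd q) by lra.
        exists ((snd p - snd v) / (snd p - snd q)); repeat split.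
        - apply Rmult_le_pos; [lra | left; apply Rinv_0_lt_compat; lra].
        - apply Rmult_le_reg_r with (1 := H0).
          unfold Rdiv; rewrite Rmult_assoc, Rinv_l; lra.
        - rewrite P, Q; ring.
        - field; lra. }
      apply tv_iff; split; intros [K | [_ K]]; try lra; right; split; trivial.
      - apply (W p q); auto.
      - apply (W q p); auto. intros S; apply N, seg_rev; trivial. }
    rewrite E. rewrite xorb_nilpotent; trivial.
  - unfold above, before.
    rewrite (tv_false ((fst p < _ <= _ \/ _) /\ _)), (tv_false (fst q < _ \/ _)) by lra.
    rewrite !xorb_false_r; apply tv_iff; split.
    + intros [_ (y & Hy & S)]; right; split; trivial.
      rewrite <- P in S.
      pose proof (seg_slice_unique p q _ _ _ ltac:(lra) S Sp); lra.
    + intros [K | [_ K]]; [lra |]; split; [lra |].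
      exists (snd p); split; trivial. rewrite <- P; trivial.
  - unfold under, above, before; rewrite !tv_false by lra; trivial.
Qed.

Lemma vertical_parity (p q v : R * R) :
  ~ seg p q v ->
  xorb (under p q v) (above p q v) = xorb (before v p) (before v q).
Proof.
  intros N; destruct (Rle_lt_dec (fst p) (fst q)) as [K | K].
  - apply vertical_parity_sorted; trivial.
  - rewrite under_rev, above_rev, (xorb_comm (before v p)).
    apply vertical_parity_sorted; [lra |]. intros S; apply N, seg_rev; trivial.
Qed.

Lemma before_total (v w : R * R) : v <> w -> before v w = negb (before w v).
Proof.
  intros N; apply tv_not; split; intros H.
  - lra.
  - destruct (Rtotal_order (fst v) (fst w)) as [E | [E | E]]; [| | tauto].
    + exfalso; tauto.
    + destruct (Rtotal_order (snd v) (snd w)) as [F | [F | F]]; try lra.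
      exfalso; apply N; rewrite <- (surj_pt v), <- (surj_pt w), E, F; trivial.
Qed.

(* A polyline is given by its first vertex and the list of the following ones. *)
Fixpoint pl_under (p : R * R) (l : list (R * R)) (v : R * R) : bool :=
  match l with
  | [] => false
  | q :: l' => xorb (under p q v) (pl_under q l' v)
  end.

Fixpoint pl_above (p : R * R) (l : list (R * R)) (v : R * R) : bool :=
  match l with
  | [] => false
  | q :: l' => xorb (above p q v) (pl_above q l' v)
  end.

Fixpoint pl_end (p : R * R) (l : list (R * R)) : R * R :=
  match l with
  | [] => p
  | q :: l' => pl_end q l'
  end.

Fixpoint pl_all (P : R * R -> R * R -> Prop) (p : R * R) (l : list (R * R)) : Prop :=
  match l with
  | [] => True
  | q :: l' => P p q /\ pl_all P q l'
  end.

Definition pl_disjoint (p : R * R) (l : list (R * R)) (q : R * R) (m : list (R * R)) : Prop :=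
  pl_all (fun a b => pl_all (seg_disjoint a b) q m) p l.

(** Summing [crossing_parity] over all pairs of segments telescopes: an inner vertex belongs to two
    consecutive segments and cancels, so only the ends of the polylines remain. *)
Lemma pl_crossing_parity (p q : R * R) (l m : list (R * R)) :
  pl_disjoint p l q m ->
  xorb (xorb (pl_under p l q) (pl_under p l (pl_end q m)))
       (xorb (pl_above q m p) (pl_above q m (pl_end p l))) = false.
Proof.
  revert p; induction l as [| p' l IH]; simpl; intros p D.
  - destruct (pl_above q m p); trivial.
  - destruct D as [D D']; specialize (IH p' D'); clear D'.
    assert (E : xorb (xorb (under p p' q) (under p p' (pl_end q m)))
       (xorb (pl_above q m p) (pl_above q m p')) = false).
    { clear IH; revert q D; induction m as [| q' m IH]; simpl; intros q D.
      - destruct (under p p' q); trivial.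
      - destruct D as [D D']; specialize (IH q' D').
        apply crossing_parity in D.
        rewrite <- (xorb_false_l false), <- D at 1; rewrite <- IH; ring. }
    rewrite <- (xorb_false_l false), <- E at 1; rewrite <- IH; ring.
Qed.

Lemma pl_vertical_parity (p v : R * R) (l : list (R * R)) :
  pl_all (fun a b => ~ seg a b v) p l ->
  xorb (pl_under p l v) (pl_above p l v) = xorb (before v p) (before v (pl_end p l)).
Proof.
  revert p; induction l as [| p' l IH]; simpl; intros p D.
  - destruct (before v p); trivial.
  - destruct D as [D D']; apply IH in D'; apply vertical_parity in D.
    replace (xorb (before v p) (before v (pl_end p' l))) with
      (xorb (xorb (before v p) (before v p')) (xorb (before v p') (before v (pl_end p' l))))
      by ring.
    rewrite <- D, <- D'; ring.
Qed.

Inductive three : Set := I0 | I1 | I2.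

(** Sum [C] over [i < k] and all [j <> l]. Terms at a vertex [a] cancel over the two choices of the
    remaining index. A term [pl_under] of [e i j] at [b l] occurs once for each [k > i], and a term
    [pl_above] of [e k l] at [b j] once for each [i < k], so modulo 2 only the middle index [I1]
    survives. [M] rewrites what is left by sides of vertical curves, and [B] makes the total odd. *)
Lemma no_K33_polylines (a b : three -> R * R) (e : three -> three -> list (R * R)) :
  (forall i j, pl_end (a i) (e i j) = b j) ->
  (forall i k j l, i <> k -> j <> l -> pl_disjoint (a i) (e i j) (a k) (e k l)) ->
  (forall j l, j <> l -> pl_all (fun p q => ~ seg p q (b l)) (a I1) (e I1 j)) ->
  (forall j l, j <> l -> b j <> b l) ->
  False.
Proof.
  intros He Hd Hv Hb.
  assert (C : forall i k j l, i <> k -> j <> l ->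
    xorb (xorb (pl_under (a i) (e i j) (a k)) (pl_under (a i) (e i j) (b l)))
         (xorb (pl_above (a k) (e k l) (a i)) (pl_above (a k) (e k l) (b j))) = false).
  { intros i k j l Hi Hj. rewrite <- (He k l), <- (He i j).
    apply pl_crossing_parity, Hd; trivial. }
  assert (M : forall j l, j <> l ->
    xorb (xorb (pl_under (a I1) (e I1 j) (b l)) (pl_above (a I1) (e I1 j) (b l)))
         (xorb (before (b l) (a I1)) (before (b l) (b j))) = false).
  { intros j l H. rewrite (pl_vertical_parity _ _ _ (Hv j l H)), He. ring. }
  assert (B : forall j l, j <> l -> xorb (before (b j) (b l)) (before (b l) (b j)) = true).
  { intros j l H. rewrite (before_total _ _ (Hb j l H)).
    destruct (before (b l) (b j)); trivial. }
  (* Each bit occurs an even number of times in the sum of the left-hand sides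
     below, but there are three right-hand sides [true]. *)
  pose proof (fun i k H H' => f_equal2 xorb (C i k I0 I1 H H')
    (f_equal2 xorb (C i k I0 I2 H ltac:(discriminate))
    (f_equal2 xorb (C i k I1 I0 H ltac:(discriminate))
    (f_equal2 xorb (C i k I1 I2 H ltac:(discriminate))
    (f_equal2 xorb (C i k I2 I0 H ltac:(discriminate))
                   (C i k I2 I1 H ltac:(discriminate))))))) as C6.
  pose proof (f_equal2 xorb (C6 I0 I1 ltac:(discriminate) ltac:(discriminate))
    (f_equal2 xorb (C6 I0 I2 ltac:(discriminate) ltac:(discriminate))
                   (C6 I1 I2 ltac:(discriminate) ltac:(discriminate)))) as C18.
  pose proof (f_equal2 xorb (M I0 I1 ltac:(discriminate))
    (f_equal2 xorb (M I0 I2 ltac:(discriminate))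
    (f_equal2 xorb (M I1 I0 ltac:(discriminate))
    (f_equal2 xorb (M I1 I2 ltac:(discriminate))
    (f_equal2 xorb (M I2 I0 ltac:(discriminate))
                   (M I2 I1 ltac:(discriminate))))))) as M6.
  pose proof (f_equal2 xorb (B I0 I1 ltac:(discriminate))
    (f_equal2 xorb (B I0 I2 ltac:(discriminate))
                   (B I1 I2 ltac:(discriminate)))) as B3.
  pose proof (f_equal2 xorb C18 (f_equal2 xorb M6 B3)) as Z.
  clear - Z; simpl in Z.
  match type of Z with ?l = _ => assert (E : l = false) by ring end.
  congruence.
Qed.

(** * Polyline approximation of arcs *)

Definition close (eps : R) (p w : R * R) : Prop :=
  Rabs (fst p - fst w) <= eps /\ Rabs (snd p - snd w) <= eps.

Definition far (S T : R * R -> Prop) (d : R) : Prop :=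
  forall w w', S w -> T w' -> ~ close d w w'.

(** Both ends of a segment are close to the same [w], so by convexity of the square around [w] the
    whole segment is. *)
Definition pl_near (S : R * R -> Prop) (eps : R) : R * R -> list (R * R) -> Prop :=
  pl_all (fun a b => exists w, S w /\ close eps a w /\ close eps b w).

Lemma pl_all_impl (P Q : R * R -> R * R -> Prop) (p : R * R) (l : list (R * R)) :
  (forall a b, P a b -> Q a b) -> pl_all P p l -> pl_all Q p l.
Proof.
  intros H; revert p; induction l as [| q l IH]; simpl; intros p; [trivial |].
  intros [K K']; auto.
Qed.

Lemma pl_all_app (P : R * R -> R * R -> Prop) (p : R * R) (l m : list (R * R)) :
  pl_all P p l -> pl_all P (pl_end p l) m -> pl_all P p (l ++ m).
Proof.
  revert p; induction l as [| q l IH]; simpl; intros p; [trivial |].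
  intros [K K']; auto.
Qed.

Lemma pl_end_app (p : R * R) (l m : list (R * R)) :
  pl_end p (l ++ m) = pl_end (pl_end p l) m.
Proof. revert p; induction l; simpl; auto. Qed.

Lemma Rabs_le_iff (x y : R) : Rabs x <= y <-> - y <= x <= y.
Proof. unfold Rabs; destruct (Rcase_abs x); lra. Qed.

Lemma close_seg (eps : R) (a b w p : R * R) :
  close eps a w -> close eps b w -> seg a b p -> close eps p w.
Proof.
  intros [A A'] [B B'] (t & Ht & E & E').
  unfold close in *; rewrite !Rabs_le_iff in *; rewrite E, E'; split; nra.
Qed.

Lemma far_seg (S T : R * R -> Prop) (eps : R) (a b w p : R * R) :
  far S T (2 * eps) -> S w -> close eps a w -> close eps b w -> seg a b p ->
  forall w', T w' -> ~ close eps p w'.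
Proof.
  intros F Hw A B Hp w' Hw' K.
  pose proof (close_seg _ _ _ _ _ A B Hp) as K'.
  apply (F w w' Hw Hw').
  unfold close in *; rewrite !Rabs_le_iff in *; lra.
Qed.

Lemma near_disjoint (S T : R * R -> Prop) (eps : R) (p q : R * R) (l m : list (R * R)) :
  far S T (2 * eps) -> pl_near S eps p l -> pl_near T eps q m -> pl_disjoint p l q m.
Proof.
  intros F Nl Nm; revert Nl; apply pl_all_impl; intros a b (w & Hw & A & B).
  revert Nm; apply pl_all_impl; intros c d (w' & Hw' & C & D) r H H'.
  apply (far_seg _ _ _ _ _ _ _ F Hw A B H w' Hw').
  apply (close_seg _ c d); trivial.
Qed.

Definition image (g : R -> R * R) (w : R * R) : Prop :=
  exists t, 0 <= t <= 1 /\ w = g t.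

(** Continuity in the form used with [compactness_value_1d]: a positive radius for every real [t],
    arbitrary outside the unit interval. *)
Lemma path_modulus (g : R -> R * R) :
  path_continuous g -> forall eps, 0 < eps -> exists delta : R -> posreal,
  forall s t, 0 <= s <= 1 -> 0 <= t <= 1 -> Rabs (s - t) < delta t ->
    Rabs (fst (g s) - fst (g t)) < eps /\ Rabs (snd (g s) - snd (g t)) < eps.
Proof.
  intros Hg eps He.
  destruct (choice (fun t (d : posreal) => forall s, 0 <= s <= 1 -> 0 <= t <= 1 ->
    Rabs (s - t) < d ->
    Rabs (fst (g s) - fst (g t)) < eps /\ Rabs (snd (g s) - snd (g t)) < eps))
    as [delta H].
  - intros t; destruct (classic (0 <= t <= 1)) as [Ht | Ht].
    + destruct (Hg t Ht eps He) as (d & Hd & H).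
      exists (mkposreal d Hd); auto.
    + exists (mkposreal 1 Rlt_0_1); tauto.
  - exists delta; auto.
Qed.

Lemma path_uniform (g : R -> R * R) (eps : R) :
  path_continuous g -> 0 < eps -> exists d, 0 < d /\
  forall s t, 0 <= s <= 1 -> 0 <= t <= 1 -> Rabs (s - t) < d -> close eps (g s) (g t).
Proof.
  intros Hg He.
  destruct (path_modulus g Hg (eps / 2) ltac:(lra)) as [delta Hd].
  (* With halved radii, a point within [d] of [s] is still within [delta u] of the center [u] found
     for [s]. *)
  assert (Hp : forall t, 0 < delta t / 2) by (intros t; destruct (delta t); simpl; lra).
  destruct (compactness_value_1d 0 1 (fun t => mkposreal _ (Hp t))) as [d H]; simpl in H.
  exists d; split; [apply cond_pos |].
  intros s t Hs Ht Hst.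
  destruct (NNPP _ (H s Hs)) as (u & Hu & Hsu & Hdu).
  pose proof (cond_pos (delta u)) as Hp'.
  destruct (Hd s u Hs Hu) as [A A']; [lra |].
  destruct (Hd t u Ht Hu) as [B B'].
  { replace (t - u) with ((s - u) - (s - t)) by ring.
    pose proof (Rabs_triang (s - u) (- (s - t))) as Q; rewrite Rabs_Ropp in Q.
    unfold Rminus at 1; lra. }
  apply Rabs_def2 in A, A', B, B'.
  unfold close; rewrite !Rabs_le_iff; lra.
Qed.

(** Compactness of the parameter square makes the positive distance between points of the two arcs
    uniform. *)
Lemma far_images (g h : R -> R * R) :
  path_continuous g -> path_continuous h ->
  (forall s t, 0 <= s <= 1 -> 0 <= t <= 1 -> g s <> h t) ->
  exists d, 0 < d /\ far (image g) (image h) d.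
Proof.
  intros Hg Hh N.
  pose (P := fun (st : R * R) (d : posreal) =>
    forall s' t', 0 <= fst st <= 1 -> 0 <= snd st <= 1 -> 0 <= s' <= 1 -> 0 <= t' <= 1 ->
      Rabs (s' - fst st) < d -> Rabs (t' - snd st) < d -> ~ close d (g s') (h t')).
  destruct (choice P) as [delta Hd].
  { intros [s t]; unfold P; simpl; clear P.
    destruct (classic (0 <= s <= 1 /\ 0 <= t <= 1)) as [[Hs Ht] | K];
      [| exists (mkposreal 1 Rlt_0_1); tauto].
    set (D := Rmax (Rabs (fst (g s) - fst (h t))) (Rabs (snd (g s) - snd (h t)))).
    assert (HD : 0 < D).
    { apply Rnot_le_lt; intros K; apply (N s t Hs Ht).
      pose proof (Rmax_l (Rabs (fst (g s) - fst (h t))) (Rabs (snd (g s) - snd (h t)))) as A.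
      pose proof (Rmax_r (Rabs (fst (g s) - fst (h t))) (Rabs (snd (g s) - snd (h t)))) as B.
      fold D in A, B.
      assert (A' : Rabs (fst (g s) - fst (h t)) <= 0) by lra.
      assert (B' : Rabs (snd (g s) - snd (h t)) <= 0) by lra.
      rewrite Rabs_le_iff in A', B'.
      rewrite <- (surj_pt (g s)), <- (surj_pt (h t)); f_equal; lra. }
    destruct (Hg s Hs (D / 4) ltac:(lra)) as (d1 & Hd1 & G1).
    destruct (Hh t Ht (D / 4) ltac:(lra)) as (d2 & Hd2 & G2).
    (* One number serves both as parameter radius and as distance bound: both points move by less
       than [D / 4], so if they came within [D / 4] of each other, [D] would be at most
       [3 * D / 4]. *)
    assert (Hm : 0 < Rmin (Rmin d1 d2) (D / 4)) by (repeat apply Rmin_pos; lra).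
    exists (mkposreal _ Hm); simpl; intros s' t' _ _ Hs' Ht' A B [C C'].
    pose proof (Rmin_l (Rmin d1 d2) (D / 4)); pose proof (Rmin_r (Rmin d1 d2) (D / 4)).
    pose proof (Rmin_l d1 d2); pose proof (Rmin_r d1 d2).
    destruct (G1 s' Hs') as [P1 P2]; [lra |].
    destruct (G2 t' Ht') as [Q1 Q2]; [lra |].
    assert (C1 : Rabs (fst (g s') - fst (h t')) <= D / 4) by lra.
    assert (C2 : Rabs (snd (g s') - snd (h t')) <= D / 4) by lra.
    rewrite Rabs_le_iff in C1, C2.
    apply Rabs_def2 in P1, P2, Q1, Q2.
    assert (D <= 3 * D / 4); [| lra].
    unfold D at 1; apply Rmax_lub; rewrite Rabs_le_iff; lra. }
  destruct (compactness_value_2d 0 1 0 1 (fun s t => delta (s, t))) as [d H].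
  exists d; split; [apply cond_pos |].
  intros w w' (s & Hs & ->) (t & Ht & ->) [K K'].
  destruct (NNPP _ (H s t Hs Ht)) as (u & v & Hu & Hv & Hsu & Htv & Hd').
  apply (Hd (u, v) s t); simpl; trivial.
  split; lra.
Qed.

Lemma arc_polyline (g : R -> R * R) (eps : R) :
  path_continuous g -> 0 < eps ->
  exists l, pl_end (g 0) l = g 1 /\ pl_near (image g) eps (g 0) l.
Proof.
  intros Hg He; destruct (path_uniform g eps Hg He) as (d & Hd & H).
  assert (W : forall n s, 0 <= s <= 1 -> 1 - s <= INR n * (d / 2) ->
    exists l, pl_end (g s) l = g 1 /\ pl_near (image g) eps (g s) l).
  { induction n as [| n IH]; intros s Hs Hn.
    - simpl in Hn; exists []; split; [simpl; f_equal; lra | exact I].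
    - rewrite S_INR in Hn.
      (* Steps of [d / 2] stay strictly below the modulus [d]; the last one is cut off at 1. *)
      set (s' := Rmin (s + d / 2) 1).
      assert (Hs' : s <= s' <= 1 /\ s' <= s + d / 2 /\ 1 - s' <= INR n * (d / 2)).
      { assert (0 <= INR n * (d / 2)) by (apply Rmult_le_pos; [apply pos_INR | lra]).
        unfold s', Rmin; destruct (Rle_dec (s + d / 2) 1); lra. }
      destruct (IH s') as (l & E & N); try lra.
      exists (g s' :: l); split; [exact E |]; split; [| exact N].
      exists (g s); split; [exists s; auto |].
      split; apply H; try lra; rewrite ?Rminus_diag, ?Rabs_R0; trivial.
      apply Rabs_def1; lra. }
  destruct (INR_unbounded (1 / (d / 2))) as [n Hn].
  apply (W n); [lra |].
  apply Rmult_lt_compat_r with (r := d / 2) in Hn; [| lra].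
  replace (1 / (d / 2) * (d / 2)) with 1 in Hn by (field; lra). lra.
Qed.

Lemma far_le (S T : R * R -> Prop) (d d' : R) : d' <= d -> far S T d -> far S T d'.
Proof. intros H F w w' Hw Hw' [K K']; apply (F w w' Hw Hw'); split; lra. Qed.

Lemma three_min (P : three -> R -> Prop) :
  (forall i d d', d' <= d -> P i d -> P i d') ->
  (forall i, exists d, 0 < d /\ P i d) -> exists d, 0 < d /\ forall i, P i d.
Proof.
  intros M H.
  destruct (H I0) as (d0 & H0 & P0), (H I1) as (d1 & H1 & P1), (H I2) as (d2 & H2 & P2).
  exists (Rmin d0 (Rmin d1 d2)); split; [repeat apply Rmin_pos; trivial |].
  pose proof (Rmin_l d0 (Rmin d1 d2)); pose proof (Rmin_r d0 (Rmin d1 d2)).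
  pose proof (Rmin_l d1 d2); pose proof (Rmin_r d1 d2).
  intros []; [apply (M _ d0) | apply (M _ d1) | apply (M _ d2)]; trivial; lra.
Qed.

(** * Excluding subdivisions of K33 from planar graphs *)

Fixpoint walk {V : Type} (adj : V -> V -> Prop) (u : V) (l : list V) : Prop :=
  match l with
  | [] => True
  | v :: l' => adj u v /\ walk adj v l'
  end.

Fixpoint walk_end {V : Type} (u : V) (l : list V) : V :=
  match l with
  | [] => u
  | v :: l' => walk_end v l'
  end.

Lemma walk_end_in {V : Type} (u : V) (l : list V) : In (walk_end u l) (u :: l).
Proof.
  revert u; induction l as [| v l IH]; intros u; [left; trivial | right; apply (IH v)].
Qed.

Definition disjoint_lists {V : Type} (l m : list V) : Prop :=
  forall x, In x l -> In x m -> False.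

(** Only arcs contribute: the trace of an empty walk is empty and omits its start, hence the
    condition [l <> []] in [Hend] below. *)
Fixpoint trace {V : Type} (arc : V -> V -> R -> R * R) (u : V) (l : list V)
    (w : R * R) : Prop :=
  match l with
  | [] => False
  | v :: l' => image (arc u v) w \/ trace arc v l' w
  end.

(** Walks with a common end may overlap here. Walks without common vertices have traces at positive
    distance, and one [d] serves all pairs; polylines within [d / 2] of the traces are then disjoint
    wherever [no_K33_polylines] asks for it. *)
Lemma planar_no_K33 (V : Type) (adj : V -> V -> Prop)
    (a b : three -> V) (p : three -> three -> list V) :
  planar_graph V adj ->
  (forall i j, walk adj (a i) (p i j)) ->
  (forall i j, walk_end (a i) (p i j) = b j) ->
  (forall i k j l, i <> k -> j <> l -> disjoint_lists (a i :: p i j) (a k :: p k l)) ->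
  False.
Proof.
  intros (f & arc & Hf & Harc & Hcross) Hw He Hd.
  assert (Harcs : forall u v u' v', adj u v -> adj u' v' ->
    disjoint_lists [u; v] [u'; v'] ->
    exists d, 0 < d /\ far (image (arc u v)) (image (arc u' v')) d).
  { intros u v u' v' A A' D.
    destruct (Harc u v A) as (Cg & _ & G0 & G1 & _).
    destruct (Harc u' v' A') as (Ch & _ & H0 & H1 & _).
    apply far_images; trivial.
    intros s t Hs Ht E.
    destruct (Hcross u v u' v' A A') with (s := s) (t := t) as [[-> | ->] [-> | ->]]; trivial.
    - intros [[<- _] | [<- _]]; apply (D u); simpl; auto.
    - rewrite G0, H0 in E; apply Hf in E; subst; apply (D u'); simpl; auto.
    - rewrite G0, H1 in E; apply Hf in E; subst; apply (D v'); simpl; auto.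
    - rewrite G1, H0 in E; apply Hf in E; subst; apply (D u'); simpl; auto.
    - rewrite G1, H1 in E; apply Hf in E; subst; apply (D v'); simpl; auto. }
  assert (Hfar : forall l u m u', walk adj u l -> walk adj u' m ->
    disjoint_lists (u :: l) (u' :: m) ->
    exists d, 0 < d /\ far (trace arc u l) (trace arc u' m) d).
  { induction l as [| v l IH]; intros u m u' Wl Wm D.
    - exists 1; split; [lra | intros w w' []].
    - destruct Wl as [A Wl].
      destruct (IH v m u' Wl Wm) as (d & Pd & F).
      { intros x Hx; apply D; right; trivial. }
      assert (exists d, 0 < d /\ far (image (arc u v)) (trace arc u' m) d) as (d' & Pd' & F').
      { clear IH F; revert u' Wm D; induction m as [| v' m IH]; intros u' Wm D.
        - exists 1; split; [lra | intros w w' _ []].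
        - destruct Wm as [A' Wm].
          destruct (IH v' Wm) as (d1 & P1 & F1).
          { intros x Hx Hx'; apply (D x); trivial; right; trivial. }
          destruct (Harcs u v u' v' A A') as (d2 & P2 & F2).
          { intros x Hx Hx'; apply (D x); simpl in *; tauto. }
          exists (Rmin d1 d2); split; [apply Rmin_pos; trivial |].
          intros w w' K [K' | K'].
          + refine (far_le _ _ _ _ (Rmin_r d1 d2) F2 w w' K K').
          + refine (far_le _ _ _ _ (Rmin_l d1 d2) F1 w w' K K'). }
      exists (Rmin d d'); split; [apply Rmin_pos; trivial |].
      intros w w' [K | K] K'.
      + refine (far_le _ _ _ _ (Rmin_r d d') F' w w' K K').
      + refine (far_le _ _ _ _ (Rmin_l d d') F w w' K K'). }
  assert (exists d, 0 < d /\ forall i k j l, i <> k -> j <> l ->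
    far (trace arc (a i) (p i j)) (trace arc (a k) (p k l)) d) as (d & Pd & F).
  { apply three_min.
    { intros i d d' Hdd' K **; apply (far_le _ _ d); auto. }
    intros i; apply three_min.
    { intros k d d' Hdd' K **; apply (far_le _ _ d); auto. }
    intros k; apply three_min.
    { intros j d d' Hdd' K **; apply (far_le _ _ d); auto. }
    intros j; apply three_min.
    { intros l d d' Hdd' K **; apply (far_le _ _ d); auto. }
    intros l; destruct (classic (i <> k /\ j <> l)) as [[Hik Hjl] | K].
    - destruct (Hfar (p i j) (a i) (p k l) (a k)) as (d & Pd & F); auto.
      exists d; auto.
    - exists 1; split; [lra | tauto]. }
  assert (Hpl : forall l u, walk adj u l -> exists m,
    pl_end (f u) m = f (walk_end u l) /\ pl_near (trace arc u l) (d / 2) (f u) m).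
  { induction l as [| v l IH]; intros u W.
    - exists []; split; [trivial | exact I].
    - destruct W as [A W]; destruct (IH v W) as (m & E & N).
      destruct (Harc u v A) as (C & _ & G0 & G1 & _).
      destruct (arc_polyline (arc u v) (d / 2) C ltac:(lra)) as (m' & E' & N').
      rewrite G0, G1 in E'; rewrite G0 in N'.
      exists (m' ++ m); rewrite pl_end_app, E'; split; [exact E |].
      apply pl_all_app; [| rewrite E'].
      + revert N'; apply pl_all_impl; intros x y (w & Hx & K); exists w; simpl; tauto.
      + revert N; apply pl_all_impl; intros x y (w & Hx & K); exists w; simpl; tauto. }
  destruct (choice (fun (ij : three * three) m =>
    pl_end (f (a (fst ij))) m = f (b (snd ij)) /\
    pl_near (trace arc (a (fst ij)) (p (fst ij) (snd ij))) (d / 2) (f (a (fst ij))) m))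
    as [e Hpe].
  { intros [i j]; simpl; rewrite <- (He i j); apply Hpl; trivial. }
  assert (Hin : forall i j, In (b j) (a i :: p i j)).
  { intros i j; rewrite <- (He i j); apply walk_end_in. }
  assert (Hend : forall l u, walk adj u l -> l <> [] -> trace arc u l (f (walk_end u l))).
  { induction l as [| v l IH]; intros u W N; [congruence |].
    destruct W as [A W]; destruct l as [| v' l].
    - left; exists 1; split; [lra |].
      destruct (Harc u v A) as (_ & _ & _ & G1 & _); auto.
    - right; apply IH; [trivial | discriminate]. }
  apply (no_K33_polylines (fun i => f (a i)) (fun j => f (b j)) (fun i j => e (i, j))).
  - intros i j; apply (Hpe (i, j)).
  - intros i k j l Hi Hj.
    apply near_disjoint with (S := trace arc (a i) (p i j)) (T := trace arc (a k) (p k l))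
      (eps := d / 2).
    + replace (2 * (d / 2)) with d by field; auto.
    + apply (Hpe (i, j)).
    + apply (Hpe (k, l)).
  - intros j l Hj.
    destruct (Hpe (I1, j)) as [_ N]; simpl in N; revert N.
    apply pl_all_impl; intros x y (w & Hx & X & Y) S.
    (* The point [f (b l)] lies on the trace of the walk from [a I0], which is far from that of the
       walk from [a I1] to [b j]. *)
    assert (T : trace arc (a I0) (p I0 l) (f (b l))).
    { rewrite <- (He I0 l); apply Hend; trivial.
      intros K; pose proof (Hin I0 l) as Q; rewrite K in Q; destruct Q as [Q | []].
      apply (Hd I0 I2 j l) with (x := b l); try discriminate; trivial.
      rewrite <- Q; left; trivial. }
    refine (far_seg _ _ (d / 2) _ _ _ _ _ Hx X Y S _ T _).
    + replace (2 * (d / 2)) with d by field; apply F; trivial; discriminate.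
    + unfold close; rewrite !Rminus_diag, Rabs_R0; lra.
  - intros j l Hj E; apply Hf in E.
    apply (Hd I0 I1 j l) with (x := b j); try discriminate; trivial.
    rewrite E; trivial.
Qed.

(** * Elementary group theory *)

Open Scope nat_scope.

Local Notation "x ** y" := (gmul _ x y) (at level 40, left associativity).

Definition commute {G : Group} (x y : G) : Prop := x ** y = y ** x.

Lemma gmul_cancel_l {G : Group} (x y z : G) : x ** y = x ** z -> y = z.
Proof.
  intros H; rewrite <- (gmul1l G y), <- (gmul1l G z), <- (gmulVl G x), <- !gmulA, H.
  reflexivity.
Qed.

Lemma gmul_cancel_r {G : Group} (x y z : G) : y ** x = z ** x -> y = z.
Proof.
  intros H; rewrite <- (gmul1r G y), <- (gmul1r G z), <- (gmulVr G x), !gmulA, H.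
  reflexivity.
Qed.

Lemma ginv_unique {G : Group} (x y : G) : x ** y = gone _ -> y = ginv G x.
Proof. intros H; apply (gmul_cancel_l x); rewrite H, gmulVr; trivial. Qed.

Lemma gidem {G : Group} (x : G) : x ** x = x -> x = gone _.
Proof. intros H; apply (gmul_cancel_l x); rewrite H, gmul1r; trivial. Qed.

Lemma commute_sym {G : Group} (x y : G) : commute x y -> commute y x.
Proof. unfold commute; auto. Qed.

Lemma commute_one {G : Group} (x : G) : commute x (gone _).
Proof. unfold commute; rewrite gmul1l, gmul1r; trivial. Qed.

Lemma commute_mul {G : Group} (x y z : G) :
  commute x y -> commute x z -> commute x (y ** z).
Proof. unfold commute; intros H H'; rewrite gmulA, H, <- gmulA, H', gmulA; trivial. Qed.

Lemma commute_inv {G : Group} (x y : G) : commute x y -> commute x (ginv G y).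
Proof.
  unfold commute; intros H; apply (gmul_cancel_l y), (gmul_cancel_r y).
  rewrite !gmulA, gmulVr, gmul1l, <- H, <- !gmulA, gmulVl, gmul1r; trivial.
Qed.

Lemma commute_mul_r_iff {G : Group} (x y z : G) :
  commute x z -> commute x (y ** z) -> commute x y.
Proof.
  intros H K.
  rewrite <- (gmul1r G y), <- (gmulVr G z), gmulA.
  apply commute_mul; [| apply commute_inv]; trivial.
Qed.

Lemma gmul_swap {G : Group} (a b c d : G) :
  commute b c -> (a ** b) ** (c ** d) = (a ** c) ** (b ** d).
Proof.
  intros H; rewrite <- !gmulA, (gmulA G b), H, !gmulA; trivial.
Qed.

Lemma gpow_add {G : Group} (x : G) (m n : nat) :
  gpow G x (m + n) = gpow G x m ** gpow G x n.
Proof.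
  induction m as [| m IH]; simpl; [rewrite gmul1l; trivial |].
  rewrite IH, gmulA; trivial.
Qed.

Lemma gpow_one {G : Group} (n : nat) : gpow G (gone G) n = gone _.
Proof. induction n as [| n IH]; simpl; [| rewrite IH, gmul1l]; trivial. Qed.

Lemma gpow_mul {G : Group} (x : G) (m n : nat) :
  gpow G x (m * n) = gpow G (gpow G x m) n.
Proof.
  induction n as [| n IH]; [rewrite Nat.mul_0_r; trivial |].
  rewrite Nat.mul_succ_r, Nat.add_comm, gpow_add, IH; trivial.
Qed.

Lemma gpow_0 {G : Group} (x : G) : gpow G x 0 = gone _.
Proof. reflexivity. Qed.

Lemma gpow_1 {G : Group} (x : G) : gpow G x 1 = x.
Proof. apply gmul1r. Qed.

Lemma gpow_2 {G : Group} (x : G) : gpow G x 2 = x ** x.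
Proof. simpl; rewrite gmul1r; trivial. Qed.

Lemma gpow_4 {G : Group} (x : G) : gpow G x 4 = (x ** x) ** (x ** x).
Proof. change 4 with (2 + 2); rewrite gpow_add, gpow_2; trivial. Qed.

Lemma gpow_mod {G : Group} (x : G) (m n : nat) :
  gpow G x m = gone _ -> gpow G x (n mod m) = gpow G x n.
Proof.
  intros H; destruct (Nat.eq_dec m 0) as [-> | Hm]; [trivial |].
  rewrite (Nat.div_mod n m) at 2 by trivial.
  rewrite gpow_add, gpow_mul, H, gpow_one, gmul1l; trivial.
Qed.

Lemma commute_pow {G : Group} (x y : G) (n : nat) :
  commute x y -> commute x (gpow G y n).
Proof.
  intros H; induction n as [| n IH]; simpl; [apply commute_one | apply commute_mul; trivial].
Qed.

Lemma commute_pow_self {G : Group} (x : G) (m n : nat) :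
  commute (gpow G x m) (gpow G x n).
Proof. apply commute_pow, commute_sym, commute_pow; unfold commute; trivial. Qed.

Lemma ginv_pow {G : Group} (x : G) (m n : nat) :
  gpow G x (m + n) = gone _ -> ginv G (gpow G x m) = gpow G x n.
Proof. intros H; symmetry; apply ginv_unique; rewrite <- gpow_add; trivial. Qed.

(** Here [K] is the union of [H] and the coset [t H]: a subgroup containing [H] and some [t h]
    contains [t], hence all of [K]. *)
Lemma maximal_in_index_two {G : Group} (H K : subgroup G) (t : G) :
  (forall x, sgset H x -> sgset K x) -> sgset K t -> ~ sgset H t ->
  (forall y, sgset K y -> sgset H y \/ exists x, sgset H x /\ y = t ** x) ->
  maximal_in H K.
Proof.
  intros HK Kt Ht I; split; [trivial |]; split; [exists t; auto |].
  intros L HL LK.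
  destruct (classic (exists y, sgset L y /\ ~ sgset H y)) as [(y & Ly & Hy) | N].
  - right; intros x; split; [apply LK |].
    intros Kx; destruct (proj2_sig L) as (_ & Lm & Li).
    destruct (I y (LK y Ly)) as [| (h & Hh & Ey)]; [tauto |].
    assert (Lt : sgset L t).
    { replace t with (y ** ginv G h).
      - apply Lm; [trivial | apply Li, HL; trivial].
      - rewrite Ey, <- gmulA, gmulVr, gmul1r; trivial. }
    destruct (I x Kx) as [| (k & Hk & ->)]; [apply HL; trivial |].
    apply Lm; [trivial | apply HL; trivial].
  - left; intros x; split; [| apply HL].
    intros Lx; apply NNPP; intros Nx; apply N; exists x; auto.
Qed.

(** * Subgroup graphs of finite groups given by multiplication tables *)

(** Exponents in [x^i y^j z^k]. One type serves all the groups considered; with fewer than three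
    generators the last exponent stays 0. *)
Definition index : Set := nat * nat * nat.

Definition ieqb (x y : index) : bool :=
  let '(i, j, k) := x in let '(i', j', k') := y in
  (i =? i') && (j =? j') && (k =? k').

Definition imem (x : index) (X : list index) : bool := existsb (ieqb x) X.

Lemma ieqb_eq (x y : index) : ieqb x y = true <-> x = y.
Proof.
  destruct x as [[i j] k], y as [[i' j'] k']; simpl.
  rewrite !andb_true_iff, !Nat.eqb_eq; split; [intros [[-> ->] ->]; trivial |].
  intros E; injection E; auto.
Qed.

Lemma imem_in (x : index) (X : list index) : imem x X = true <-> In x X.
Proof.
  unfold imem; rewrite existsb_exists; split.
  - intros (y & Hy & E); apply ieqb_eq in E; subst; trivial.
  - intros H; exists x; rewrite ieqb_eq; auto.
Qed.

Definition ione : index := (0, 0, 0).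

Definition box (l m n : nat) : list index :=
  list_prod (list_prod (seq 0 l) (seq 0 m)) (seq 0 n).

(** Any [x], [y] have a quotient [t] with [x t = y], trivial only if [x = y]; by this a
    multiplicative map with trivial kernel is injective on [dom]. *)
Definition is_table (op : index -> index -> index) (dom : list index) : bool :=
  ieqb (op ione ione) ione && imem ione dom &&
  forallb (fun x => forallb (fun y =>
    existsb (fun t => ieqb (op x t) y && (negb (ieqb t ione) || ieqb x y)) dom) dom) dom.

Definition is_sub (op : index -> index -> index) (dom X : list index) : bool :=
  imem ione X &&
  forallb (fun x => imem x dom && existsb (fun y => ieqb (op x y) ione) X &&
                    forallb (fun y => imem (op x y) X) X) X.

Definition is_index_two (op : index -> index -> index) (X Y : list index) : bool :=
  forallb (fun x => imem x Y) X &&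
  existsb (fun t => negb (imem t X) &&
    forallb (fun y => imem y X || existsb (fun x => ieqb y (op t x)) X) Y) Y.

Fixpoint is_walk (op : index -> index -> index) (X : list index)
    (l : list (list index)) : bool :=
  match l with
  | [] => true
  | Y :: l' => (is_index_two op X Y || is_index_two op Y X) && is_walk op Y l'
  end.

Definition differ (X Y : list index) : bool :=
  existsb (fun x => negb (imem x Y)) X || existsb (fun y => negb (imem y X)) Y.

Definition three_all (f : three -> bool) : bool := f I0 && f I1 && f I2.

Definition three_neq (i j : three) : bool :=
  match i, j with I0, I0 | I1, I1 | I2, I2 => false | _, _ => true end.

(** Collects the finite checks behind [planar_no_K33] in one boolean, which [vm_compute] evaluates
    for each concrete group. *)
Definition is_K33 (op : index -> index -> index) (dom : list index)
    (a : three -> list index) (p : three -> three -> list (list index)) : bool :=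
  is_table op dom &&
  three_all (fun i => three_all (fun j =>
    forallb (is_sub op dom) (a i :: p i j) && is_walk op (a i) (p i j) &&
    three_all (fun k => three_all (fun l => negb (three_neq i k && three_neq j l) ||
      forallb (fun X => forallb (differ X) (a k :: p k l)) (a i :: p i j))))).

(* Four squarings reach all products of up to 16 factors, which is enough for
   the groups of order at most 16 considered below. *)
Definition span (op : index -> index -> index) (X : list index) : list index :=
  Nat.iter 4 (fun X =>
    fold_right (fun x Y => if imem x Y then Y else x :: Y) []
      (flat_map (fun x => map (op x) X) X)) (ione :: X).

Lemma three_all_true (f : three -> bool) : three_all f = true -> forall i, f i = true.
Proof. unfold three_all; rewrite !andb_true_iff; intros H []; tauto. Qed.

Lemma three_neq_true (i j : three) : i <> j -> three_neq i j = true.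
Proof. destruct i, j; trivial; congruence. Qed.

Lemma walk_map {V W : Type} (adj : V -> V -> Prop) (adj' : W -> W -> Prop) (f : V -> W)
    (u : V) (l : list V) :
  (forall x y, In x (u :: l) -> In y (u :: l) -> adj x y -> adj' (f x) (f y)) ->
  walk adj u l -> walk adj' (f u) (map f l).
Proof.
  revert u; induction l as [| v l IH]; simpl; intros u H; [trivial |].
  intros [A W']; split; [apply H; simpl; auto |].
  apply IH; [intros x y Hx Hy; apply H; auto | trivial].
Qed.

Lemma walk_end_map {V W : Type} (f : V -> W) (u : V) (l : list V) :
  walk_end (f u) (map f l) = f (walk_end u l).
Proof. revert u; induction l; simpl; auto. Qed.

Lemma is_walk_walk (op : index -> index -> index) (X : list index) (l : list (list index)) :
  is_walk op X l = true ->
  walk (fun X Y => is_index_two op X Y = true \/ is_index_two op Y X = true) X l.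
Proof.
  revert X; induction l as [| Y l IH]; simpl; intros X; [trivial |].
  rewrite andb_true_iff, orb_true_iff; intros [H H']; auto.
Qed.

(** The map [psi] embeds the table into [G] and carries subgroups of index two to maximal ones, so
    walks in the table become walks in the subgroup graph of [G]. *)
Lemma table_not_planar (G : Group) (op : index -> index -> index) (dom : list index)
    (psi : index -> G) (a b : three -> list index)
    (p : three -> three -> list (list index)) :
  (forall x y, In x dom -> In y dom -> psi (op x y) = psi x ** psi y) ->
  (forall x, In x dom -> psi x = gone _ -> x = ione) ->
  is_K33 op dom a p = true ->
  (forall i j, walk_end (a i) (p i j) = b j) ->
  ~ planar_group G.
Proof.
  intros Hop Hker HK He HG.
  apply andb_true_iff in HK as [HT HK].
  unfold is_table in HT; rewrite !andb_true_iff, ieqb_eq, imem_in in HT.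
  destruct HT as [[Hone Hdom] Hdiv].
  assert (Hpsi1 : psi ione = gone _) by (apply gidem; rewrite <- Hop, Hone; trivial).
  assert (Hinj : forall x y, In x dom -> In y dom -> psi x = psi y -> x = y).
  { intros x y Hx Hy E.
    rewrite forallb_forall in Hdiv; specialize (Hdiv x Hx).
    rewrite forallb_forall in Hdiv; specialize (Hdiv y Hy).
    apply existsb_exists in Hdiv as (t & Ht & K).
    rewrite andb_true_iff, orb_true_iff, negb_true_iff, !ieqb_eq in K.
    destruct K as [K [K' | K']]; [| trivial].
    assert (T : t = ione).
    { apply Hker; trivial. apply (gmul_cancel_l (psi x)).
      rewrite <- Hop, K, gmul1r; auto. }
    apply ieqb_eq in T; congruence. }
  assert (Hsub : forall X, is_sub op dom X = true ->
    In ione X /\ incl X dom /\ (forall x, In x X -> exists y, In y X /\ op x y = ione) /\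
    (forall x y, In x X -> In y X -> In (op x y) X)).
  { intros X H; apply andb_true_iff in H as [H1 H]; apply imem_in in H1.
    rewrite forallb_forall in H.
    split; [trivial |]; repeat split.
    - intros x Hx; specialize (H x Hx); rewrite !andb_true_iff, imem_in in H; tauto.
    - intros x Hx; specialize (H x Hx); rewrite !andb_true_iff, existsb_exists in H.
      destruct H as [[_ (y & Hy & E)] _]; apply ieqb_eq in E; eauto.
    - intros x y Hx Hy; specialize (H x Hx); rewrite !andb_true_iff, !forallb_forall in H.
      apply imem_in; apply H; trivial. }
  destruct (choice (fun X (F : subgroup G) => is_sub op dom X = true ->
    forall g, sgset F g <-> In g (map psi X))) as [F HF].
  { intros X; destruct (is_sub op dom X) eqn:E.
    - destruct (Hsub X E) as (S1 & Sd & Si & Sm).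
      assert (S : is_subgroup G (fun g => In g (map psi X))).
      { split; [rewrite <- Hpsi1; apply in_map; trivial |]; split.
        - intros x y; rewrite !in_map_iff; intros (u & <- & Hu) (v & <- & Hv).
          exists (op u v); auto.
        - intros x; rewrite !in_map_iff; intros (u & <- & Hu).
          destruct (Si u Hu) as (v & Hv & K).
          exists v; split; trivial.
          apply ginv_unique; rewrite <- Hop, K; auto. }
      exists (exist _ _ S); intros _ g; simpl; tauto.
    (* Default value for lists that are not subgroups: the whole of [G]. *)
    - assert (S : is_subgroup G (fun _ => True)) by (repeat split).
      exists (exist _ _ S); discriminate. }
  assert (Hmax : forall X Y, is_sub op dom X = true -> is_sub op dom Y = true ->
    is_index_two op X Y = true -> maximal_in (F X) (F Y)).
  { intros X Y HX HY H.
    destruct (Hsub X HX) as (_ & Xd & _), (Hsub Y HY) as (_ & Yd & _).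
    unfold is_index_two in H; rewrite andb_true_iff, forallb_forall, existsb_exists in H.
    destruct H as [HXY (t & Ht & H)].
    rewrite andb_true_iff, negb_true_iff, forallb_forall in H; destruct H as [Nt H].
    apply (maximal_in_index_two _ _ (psi t)); intros; rewrite ?HF in * by trivial.
    - rewrite in_map_iff in *; destruct H0 as (u & <- & Hu).
      exists u; split; trivial; apply imem_in; auto.
    - apply in_map; trivial.
    - rewrite in_map_iff; intros (u & E & Hu).
      apply Hinj in E; auto; subst u; apply imem_in in Hu; congruence.
    - rewrite in_map_iff in H0; destruct H0 as (u & <- & Hu).
      specialize (H u Hu); rewrite orb_true_iff, imem_in, existsb_exists in H.
      destruct H as [H | (v & Hv & E)]; [left; apply in_map; trivial |].
      apply ieqb_eq in E; subst u; right; exists (psi v).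
      split; [rewrite HF by trivial; apply in_map; trivial | auto]. }
  assert (HK' : forall i j, (forall X, In X (a i :: p i j) -> is_sub op dom X = true) /\
    is_walk op (a i) (p i j) = true /\
    forall k l, i <> k -> j <> l -> forall X Y, In X (a i :: p i j) -> In Y (a k :: p k l) ->
      differ X Y = true).
  { intros i j; apply three_all_true with (i := i) in HK.
    apply three_all_true with (i := j) in HK.
    rewrite !andb_true_iff, forallb_forall in HK; destruct HK as [[H1 H2] H3].
    split; [trivial |]; split; [trivial |]; intros k l Hk Hl X Y HX HY.
    apply three_all_true with (i := k) in H3; apply three_all_true with (i := l) in H3.
    rewrite !three_neq_true, orb_false_l, forallb_forall in H3 by trivial.
    specialize (H3 X HX); rewrite forallb_forall in H3; auto. }
  apply (planar_no_K33 _ _ (fun i => F (a i)) (fun j => F (b j))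
           (fun i j => map F (p i j)) HG).
  - intros i j; destruct (HK' i j) as (Hs & W & _).
    apply is_walk_walk in W; revert W; apply walk_map.
    intros X Y HX HY [H | H]; [left | right]; apply Hmax; auto.
  - intros i j; rewrite walk_end_map, He; trivial.
  - intros i k j l Hi Hj; rewrite <- !map_cons; intros S.
    rewrite !in_map_iff; intros (X & EX & HX) (Y & EY & HY).
    destruct (HK' i j) as (Hs & _ & D), (HK' k l) as (Hs' & _).
    specialize (D k l Hi Hj X Y HX HY).
    specialize (Hs X HX); specialize (Hs' Y HY).
    (* A subgroup common to both walks would be the image of two lists with the same elements,
       against [differ]. *)
    assert (E : forall x, In x dom -> In x X <-> In x Y).
    { assert (E : forall Z, is_sub op dom Z = true -> F Z = S ->
        forall x, In x dom -> In x Z <-> sgset S (psi x)).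
      { intros Z HZ <- x Hx; rewrite HF, in_map_iff by trivial; split; [eauto |].
        intros (y & Ey & Hy); apply Hinj in Ey; [subst; trivial | | trivial].
        destruct (Hsub Z HZ) as (_ & Zd & _); auto. }
      intros x Hx; rewrite (E X), (E Y); tauto. }
    destruct (Hsub X Hs) as (_ & Xd & _), (Hsub Y Hs') as (_ & Yd & _).
    unfold differ in D; rewrite orb_true_iff, !existsb_exists in D.
    destruct D as [(x & Hx & N) | (x & Hx & N)];
      apply negb_true_iff in N; pose proof Hx as Hx'; apply E in Hx'; auto;
      apply imem_in in Hx'; congruence.
Qed.

(** * The three excluded finite groups *)

Definition triple_pow {G : Group} (x y z : G) (t : index) : G :=
  let '(i, j, k) := t in gpow G x i ** gpow G y j ** gpow G z k.

Definition abelian_op (l m n : nat) (s t : index) : index :=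
  let '(i, j, k) := s in let '(i', j', k') := t in
  ((i + i') mod l, (j + j') mod m, (k + k') mod n).

Lemma triple_pow_abelian {G : Group} (x y z : G) (l m n : nat) (s t : index) :
  commute x y -> commute x z -> commute y z ->
  gpow G x l = gone _ -> gpow G y m = gone _ -> gpow G z n = gone _ ->
  triple_pow x y z (abelian_op l m n s t) = triple_pow x y z s ** triple_pow x y z t.
Proof.
  destruct s as [[i j] k], t as [[i' j'] k']; simpl; intros Hxy Hxz Hyz Hx Hy Hz.
  rewrite !gpow_mod, !gpow_add by trivial.
  assert (C : forall (u v : G) q r, commute u v -> commute (gpow G u q) (gpow G v r)).
  { intros u v q r H; apply commute_pow, commute_sym, commute_pow, commute_sym, H. }
  rewrite (gmul_swap (gpow G x i ** gpow G y j) (gpow G z k)).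
  - rewrite (gmul_swap (gpow G x i) (gpow G y j)); auto using commute_sym.
  - apply commute_mul; auto using commute_sym.
Qed.

(* The subgroups of order two of [V = <x^2, y^2>] against [1], [V] and the group. *)
Definition C4C4_K33 (i j : three) : list (list index) :=
  let sp := span (abelian_op 4 4 1) in
  let V := sp [(2, 0, 0); (0, 2, 0)] in
  let T := sp [(1, 0, 0); (0, 1, 0)] in
  match j with
  | I0 => [[ione]]
  | I1 => [V]
  | I2 => match i with
          | I0 => [sp [(1, 0, 0)]; sp [(1, 0, 0); (0, 2, 0)]; T]
          | I1 => [sp [(0, 1, 0)]; sp [(0, 1, 0); (2, 0, 0)]; T]
          | I2 => [sp [(1, 1, 0)]; sp [(1, 1, 0); (2, 0, 0)]; T]
          end
  end.

Definition C4C4_left (i : three) : list index :=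
  span (abelian_op 4 4 1)
    [match i with I0 => (2, 0, 0) | I1 => (0, 2, 0) | I2 => (2, 2, 0) end].

(** The subgroups of order two of [V = <x, y>] against 1, [V] and the whole group; the last is
    reached by adjoining [z] first. *)
Definition C2C2C2_K33 (i j : three) : list (list index) :=
  let sp := span (abelian_op 2 2 2) in
  match j with
  | I0 => [[ione]]
  | I1 => [sp [(1, 0, 0); (0, 1, 0)]]
  | I2 => [sp [match i with I0 => (1, 0, 0) | I1 => (0, 1, 0) | I2 => (1, 1, 0) end;
               (0, 0, 1)];
           sp [(1, 0, 0); (0, 1, 0); (0, 0, 1)]]
  end.

Definition C2C2C2_left (i : three) : list index :=
  span (abelian_op 2 2 2)
    [match i with I0 => (1, 0, 0) | I1 => (0, 1, 0) | I2 => (1, 1, 0) end].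

(** Moving [s] past [r^i'] inverts the latter, and [8 - i'] is its inverse exponent, free of
    truncation for [i' < 8]. *)
Definition D16_op (s t : index) : index :=
  let '(i, j, _) := s in let '(i', j', _) := t in
  ((i + (if j =? 0 then i' else 8 - i')) mod 8, (j + j') mod 2, 0).

(* [(i, j, 0)] stands for [r^i s^j]; the nine walks join [<r^4, s>], [<r^4, r^2 s>]
   and [<r^2>] to [<r^4>], [<r^2, s>] and [1]. *)
Definition D16_K33 (i j : three) : list (list index) :=
  let sp := span D16_op in
  match j with
  | I0 => [sp [(4, 0, 0)]]
  | I1 => [sp [(2, 0, 0); (0, 1, 0)]]
  | I2 => match i with
          | I0 => [sp [(0, 1, 0)]; [ione]]
          | I1 => [sp [(2, 1, 0)]; [ione]]
          | I2 => [sp [(2, 0, 0); (1, 1, 0)]; sp [(4, 0, 0); (1, 1, 0)];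
                   sp [(1, 1, 0)]; [ione]]
          end
  end.

Definition D16_left (i : three) : list index :=
  span D16_op
    match i with
    | I0 => [(4, 0, 0); (0, 1, 0)]
    | I1 => [(4, 0, 0); (2, 1, 0)]
    | I2 => [(2, 0, 0)]
    end.

Lemma commute_pows {G : Group} (x y : G) (m n : nat) :
  commute x y -> commute (gpow G x m) (gpow G y n).
Proof. intros H; apply commute_pow, commute_sym, commute_pow, commute_sym, H. Qed.

Lemma triple_pow_1 {G : Group} (x y z : G) (i j : nat) :
  triple_pow x y z (i, j, 0) = gpow G x i ** gpow G y j.
Proof. apply gmul1r. Qed.

(** If [c] lay outside the four-group [<a, b>], the three elements would generate an elementary
    abelian group of order 8. *)
Lemma planar_C2C2C2 {G : Group} (a b c : G) :
  planar_group G -> commute a b -> commute a c -> commute b c ->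
  a ** a = gone G -> b ** b = gone G -> c ** c = gone G ->
  a <> gone G -> b <> gone G -> a <> b ->
  c = gone G \/ c = a \/ c = b \/ c = a ** b.
Proof.
  intros HG Hab Hac Hbc Ha Hb Hc Na Nb Nab; apply NNPP; intros N; revert HG.
  assert (Nc : forall d, d ** d = gone G -> d ** c = gone G -> c = d).
  { intros d Hd K; apply (gmul_cancel_l d); congruence. }
  assert (Hab2 : (a ** b) ** (a ** b) = gone G).
  { rewrite gmul_swap, Ha, Hb, gmul1l by (apply commute_sym; trivial); trivial. }
  apply (table_not_planar G (abelian_op 2 2 2) (box 2 2 2) (triple_pow a b c) C2C2C2_left
    (fun j => match j with
              | I0 => [ione]
              | I1 => span (abelian_op 2 2 2) [(1, 0, 0); (0, 1, 0)]
              | I2 => span (abelian_op 2 2 2) [(1, 0, 0); (0, 1, 0); (0, 0, 1)]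
              end) C2C2C2_K33).
  - intros x y _ _; apply triple_pow_abelian; rewrite ?gpow_2; trivial.
  - intros x Hx; simpl in Hx.
    assert (Ea : gpow G a 1 = a) by apply gpow_1.
    assert (Eb : gpow G b 1 = b) by apply gpow_1.
    assert (Ec : gpow G c 1 = c) by apply gpow_1.
    destruct Hx as [<- | [<- | [<- | [<- | [<- | [<- | [<- | [<- | []]]]]]]]];
      unfold triple_pow; rewrite ?Ea, ?Eb, ?Ec; rewrite ?gpow_0, ?gmul1l, ?gmul1r; intros K; try reflexivity; exfalso; try tauto.
    + apply N; right; right; left; auto.
    + apply N; right; left; auto.
    + apply Nab, (gmul_cancel_r b); congruence.
    + apply N; right; right; right; auto.
  - vm_compute; reflexivity.
  - intros [] []; reflexivity.
Qed.

Lemma planar_C4C4 {G : Group} (x y : G) :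
  planar_group G -> commute x y -> gpow G x 4 = gone G -> gpow G y 4 = gone G ->
  x ** x <> gone G -> y ** y <> gone G -> x ** x = y ** y.
Proof.
  intros HG Hxy Hx Hy Nx Ny; apply NNPP; intros Nxy; revert HG.
  apply (table_not_planar G (abelian_op 4 4 1) (box 4 4 1) (triple_pow x y (gone G))
    C4C4_left
    (fun j => match j with
              | I0 => [ione]
              | I1 => span (abelian_op 4 4 1) [(2, 0, 0); (0, 2, 0)]
              | I2 => span (abelian_op 4 4 1) [(1, 0, 0); (0, 1, 0)]
              end) C4C4_K33).
  - intros s t _ _; apply triple_pow_abelian; trivial; try apply commute_one.
    apply gpow_one.
  (* Squaring a relation between [x] and [y] gives one between the distinct involutions [x^2] and
     [y^2], which forces even exponents. *)
  - assert (W : forall i j, gpow G x i ** gpow G y j = gone G ->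
      Nat.even i = true /\ Nat.even j = true).
    { intros i j E.
      assert (E2 : gpow G (x ** x) i ** gpow G (y ** y) j = gone G).
      { rewrite <- !gpow_2, <- !gpow_mul, (Nat.mul_comm 2 i), (Nat.mul_comm 2 j), !gpow_mul,
          !gpow_2, gmul_swap, E, gmul1l; [trivial |].
        apply commute_pows; trivial. }
      rewrite <- (gpow_mod (x ** x) 2), <- (gpow_mod (y ** y) 2) in E2
        by (rewrite gpow_2, <- gpow_4; trivial).
      rewrite <- !Nat.bit0_mod, !Nat.bit0_odd, <- !Nat.negb_even in E2.
      destruct (Nat.even i), (Nat.even j); simpl in E2;
        rewrite ?gmul1l, ?gmul1r in E2; try tauto.
      exfalso; apply Nxy, (gmul_cancel_r (y ** y)).
      rewrite E2, <- gpow_4; auto. }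
    intros [[i j] k] Ht E.
    apply in_prod_iff in Ht as [Ht Hk]; apply in_prod_iff in Ht as [Hi Hj].
    apply in_seq in Hi, Hj, Hk.
    assert (k = 0) as -> by lia. rewrite triple_pow_1 in E.
    destruct (W i j E) as [Ei Ej].
    apply Nat.even_spec in Ei as [i' ->], Ej as [j' ->].
    assert (Hi' : i' = 0 \/ i' = 1) by lia. assert (Hj' : j' = 0 \/ j' = 1) by lia.
    destruct Hi' as [-> | ->], Hj' as [-> | ->]; trivial; exfalso; revert E;
      change (2 * 0) with 0; change (2 * 1) with 2; rewrite ?gpow_2, ?gpow_0, ?gmul1l, ?gmul1r; trivial.
    intros E; apply Nxy, (gmul_cancel_r (y ** y)); rewrite E, <- gpow_4; auto.
  - vm_compute; reflexivity.
  - intros [] []; reflexivity.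
Qed.

Lemma planar_D16 {G : Group} (r s : G) :
  planar_group G -> s ** s = gone G -> s ** r ** s = ginv G r ->
  gpow G r 8 = gone G -> gpow G r 4 = gone G.
Proof.
  intros HG Hs Hsr Hr; apply NNPP; intros Nr; revert HG.
  assert (Hsi : forall i, i <= 8 -> s ** gpow G r i = gpow G r (8 - i) ** s).
  { intros i Hi; apply (gmul_cancel_r s).
    rewrite <- (gmulA G (gpow G r (8 - i))), Hs, gmul1r, <- (ginv_pow r i (8 - i))
      by (replace (i + (8 - i)) with 8 by lia; trivial).
    apply ginv_unique; clear Hi; induction i as [| i IH]; simpl.
    - rewrite gmul1r, gmul1l; trivial.
    - replace (s ** (r ** gpow G r i) ** s) with ((s ** r ** s) ** (s ** gpow G r i ** s)).
      + rewrite Hsr.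
        replace (r ** gpow G r i) with (gpow G r i ** r)
          by (apply commute_sym, commute_pow; unfold commute; trivial).
        rewrite <- !gmulA, (gmulA G r), gmulVr, gmul1l, !gmulA; rewrite !gmulA in IH.
        trivial.
      + rewrite !gmulA, <- (gmulA G (s ** r) s s), Hs, gmul1r; trivial. }
  apply (table_not_planar G D16_op (box 8 2 1) (triple_pow r s (gone G)) D16_left
    (fun j => match j with
              | I0 => span D16_op [(4, 0, 0)]
              | I1 => span D16_op [(2, 0, 0); (0, 1, 0)]
              | I2 => [ione]
              end) D16_K33).
  - intros [[i j] k] [[i' j'] k'] H H'.
    apply in_prod_iff in H as [H Hk]; apply in_prod_iff in H as [Hi Hj].
    apply in_prod_iff in H' as [H' Hk']; apply in_prod_iff in H' as [Hi' Hj'].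
    apply in_seq in Hi, Hj, Hk, Hi', Hj', Hk'.
    assert (k = 0) as -> by lia; assert (k' = 0) as -> by lia.
    unfold D16_op; rewrite !triple_pow_1.
    rewrite !gpow_mod, !gpow_add by (rewrite ?gpow_2; trivial).
    rewrite !gmulA; f_equal; rewrite <- !gmulA; f_equal.
    assert (j = 0 \/ j = 1) as [-> | ->] by lia; simpl (_ =? _); cbv iota.
    + rewrite gpow_0, gmul1l, gmul1r; trivial.
    + rewrite gpow_1; symmetry; apply Hsi; lia.
  - intros [[i j] k] H E.
    apply in_prod_iff in H as [H Hk]; apply in_prod_iff in H as [Hi Hj].
    apply in_seq in Hi, Hj, Hk.
    assert (k = 0) as -> by lia; rewrite triple_pow_1 in E.
    assert (j = 0 \/ j = 1) as [-> | ->] by lia.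
    + rewrite gpow_0, gmul1r in E.
      destruct (Nat.eq_dec i 0) as [-> | Hi0]; [trivial |]; exfalso; apply Nr.
      assert (Hp : forall m, gpow G r (i * m) = gone G)
        by (intros m; rewrite gpow_mul, E, gpow_one; trivial).
      (* Each nonzero [i] modulo 8 has a multiple congruent to 4, so [r^i = 1] would give
         [r^4 = 1]. *)
      assert (exists m, (i * m) mod 8 = 4) as [m Hm].
      { assert (Hc : i = 1 \/ i = 2 \/ i = 3 \/ i = 4 \/ i = 5 \/ i = 6 \/ i = 7) by lia.
        destruct Hc as [-> | [-> | [-> | [-> | [-> | [-> | ->]]]]]];
          [exists 4 | exists 2 | exists 4 | exists 1 | exists 4 | exists 2 | exists 4];
          reflexivity. }
      rewrite <- Hm, gpow_mod; auto.
    (* If [s] were a power of [r], it would both commute with [r] and invert it, so that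
       [r^2 = 1]. *)
    + exfalso; apply Nr; rewrite gpow_1 in E.
      assert (C : commute r s).
      { rewrite (ginv_unique _ _ E).
        apply commute_inv, commute_pow; unfold commute; trivial. }
      assert (E2 : r ** r = gone G).
      { assert (Er : r = ginv G r)
          by (rewrite <- Hsr, <- C, <- gmulA, Hs, gmul1r; trivial).
        rewrite Er at 2; apply gmulVr. }
      rewrite gpow_4, E2, gmul1l; trivial.
  - vm_compute; reflexivity.
  - intros [] []; reflexivity.
Qed.

Lemma planar_pullback {V W : Type} (adjV : V -> V -> Prop) (adjW : W -> W -> Prop)
    (phi : V -> W) :
  (forall u v, phi u = phi v -> u = v) ->
  (forall u v, adjV u v -> adjW (phi u) (phi v)) ->
  planar_graph W adjW -> planar_graph V adjV.
Proof.
  intros Hi Ha (f & arc & Hf & Harc & Hcross).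
  exists (fun v => f (phi v)), (fun u v => arc (phi u) (phi v)).
  split; [auto |]; split.
  - intros u v A; destruct (Harc _ _ (Ha u v A)) as (H1 & H2 & H3 & H4 & H5).
    repeat split; auto; apply H1; trivial.
  - intros u v u' v' A A' N; apply Hcross; auto.
    intros [[E E'] | [E E']]; apply Hi in E, E'; tauto.
Qed.

Lemma subgroup_ext {G : Group} (H K : subgroup G) :
  (forall x, sgset H x <-> sgset K x) -> H = K.
Proof.
  destruct H as [H HH], K as [K HK]; simpl; intros E.
  assert (H = K) as <-.
  { apply functional_extensionality; intros x; apply propositional_extensionality, E. }
  f_equal; apply proof_irrelevance.
Qed.

(** * The quotient of the centralizer of an involution *)

(* Cosets of [<a>] are represented by a chosen element, so that equality in the
   quotient is Leibniz equality. *)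
Definition rep {G : Group} (a x : G) : G :=
  epsilon (inhabits (gone G)) (fun y => y = x \/ y = x ** a).

Lemma rep_cases {G : Group} (a x : G) : rep a x = x \/ rep a x = x ** a.
Proof. apply (epsilon_spec (inhabits (gone G)) (fun y => y = x \/ y = x ** a)); eauto. Qed.

Lemma rep_mul {G : Group} (a x : G) : a ** a = gone G -> rep a (x ** a) = rep a x.
Proof.
  intros Ha; unfold rep; f_equal.
  apply functional_extensionality; intros y; apply propositional_extensionality.
  rewrite <- gmulA, Ha, gmul1r; tauto.
Qed.

Lemma rep_stable {G : Group} (a x : G) :
  a ** a = gone G -> commute a x -> commute a (rep a x) /\ rep a (rep a x) = rep a x.
Proof.
  intros Ha H; destruct (rep_cases a x) as [E | E]; rewrite E; [auto |].
  rewrite rep_mul, E by trivial; split; trivial.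
  apply commute_mul; unfold commute; trivial.
Qed.

Definition coset {G : Group} (a : G) : Type := {x : G | commute a x /\ rep a x = x}.

Definition pi {G : Group} {a : G} (Ha : a ** a = gone G) (x : G) (H : commute a x) :
  coset a := exist _ (rep a x) (rep_stable a x Ha H).

Lemma coset_eq {G : Group} {a : G} (q q' : coset a) : proj1_sig q = proj1_sig q' -> q = q'.
Proof.
  destruct q as [x H], q' as [x' H']; simpl; intros <-; f_equal; apply proof_irrelevance.
Qed.

Lemma pi_proj {G : Group} {a : G} (Ha : a ** a = gone G) (q : coset a) :
  q = pi Ha (proj1_sig q) (proj1 (proj2_sig q)).
Proof. apply coset_eq; simpl; symmetry; apply (proj2_sig q). Qed.

Lemma pi_surj {G : Group} {a : G} (Ha : a ** a = gone G) (q : coset a) :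
  exists x H, q = pi Ha x H.
Proof. do 2 eexists; apply pi_proj. Qed.

Lemma pi_eq {G : Group} {a : G} (Ha : a ** a = gone G) (x y : G)
    (H : commute a x) (H' : commute a y) :
  x = y \/ x = y ** a -> pi Ha x H = pi Ha y H'.
Proof.
  intros E; apply coset_eq; simpl; destruct E as [-> | ->]; [| apply rep_mul]; trivial.
Qed.

Lemma pi_inj {G : Group} {a : G} (Ha : a ** a = gone G) (x y : G)
    (H : commute a x) (H' : commute a y) :
  pi Ha x H = pi Ha y H' -> x = y \/ x = y ** a.
Proof.
  intros E; apply (f_equal (@proj1_sig _ _)) in E; simpl in E.
  destruct (rep_cases a x) as [K | K], (rep_cases a y) as [K' | K']; rewrite K, K' in E.
  - auto.
  - auto.
  - right; rewrite <- E, <- gmulA, Ha, gmul1r; trivial.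
  - left; apply (gmul_cancel_r a); trivial.
Qed.

Definition coset_mul {G : Group} {a : G} (Ha : a ** a = gone G) (q r : coset a) : coset a :=
  pi Ha (proj1_sig q ** proj1_sig r)
    (commute_mul _ _ _ (proj1 (proj2_sig q)) (proj1 (proj2_sig r))).

Lemma coset_mul_pi {G : Group} {a : G} (Ha : a ** a = gone G) (x y : G)
    (H : commute a x) (H' : commute a y) (K : commute a (x ** y)) :
  coset_mul Ha (pi Ha x H) (pi Ha y H') = pi Ha (x ** y) K.
Proof.
  unfold coset_mul; apply pi_eq; simpl.
  destruct (rep_cases a x) as [-> | ->], (rep_cases a y) as [-> | ->];
    rewrite ?gmulA; auto.
  - right; rewrite <- !gmulA, H'; trivial.
  - left; rewrite <- (gmulA G x a y), H', gmulA, <- gmulA, Ha, gmul1r; trivial.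
Qed.

Definition coset_inv {G : Group} {a : G} (Ha : a ** a = gone G) (q : coset a) : coset a :=
  pi Ha (ginv G (proj1_sig q)) (commute_inv _ _ (proj1 (proj2_sig q))).

Definition coset_one {G : Group} {a : G} (Ha : a ** a = gone G) : coset a :=
  pi Ha (gone G) (commute_one a).

Definition quotient {G : Group} {a : G} (Ha : a ** a = gone G) : Group.
Proof.
  refine (Build_Group (coset a) (coset_mul Ha) (coset_one Ha) (coset_inv Ha) _ _ _ _ _).
  - intros q r s.
    destruct (pi_surj Ha q) as (x & H & ->), (pi_surj Ha r) as (y & H' & ->),
      (pi_surj Ha s) as (z & H'' & ->).
    rewrite (coset_mul_pi Ha _ _ _ _ (commute_mul _ _ _ H' H'')).
    rewrite (coset_mul_pi Ha _ _ _ _ (commute_mul _ _ _ H (commute_mul _ _ _ H' H''))).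
    rewrite (coset_mul_pi Ha _ _ _ _ (commute_mul _ _ _ H H')).
    rewrite (coset_mul_pi Ha _ _ _ _ (commute_mul _ _ _ (commute_mul _ _ _ H H') H'')).
    apply pi_eq; rewrite gmulA; auto.
  - intros q; destruct (pi_surj Ha q) as (x & H & ->).
    unfold coset_one; rewrite (coset_mul_pi Ha _ _ _ _ (commute_mul _ _ _ (commute_one a) H)).
    apply pi_eq; rewrite gmul1l; auto.
  - intros q; destruct (pi_surj Ha q) as (x & H & ->).
    unfold coset_one; rewrite (coset_mul_pi Ha _ _ _ _ (commute_mul _ _ _ H (commute_one a))).
    apply pi_eq; rewrite gmul1r; auto.
  - intros q; pose proof (proj1 (proj2_sig q)) as C.
    etransitivity; [apply f_equal, (pi_proj Ha q) |].
    unfold coset_inv; rewrite (coset_mul_pi Ha _ _ _ _ (commute_mul _ _ _ (commute_inv _ _ C) C)).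
    apply pi_eq; rewrite gmulVl; auto.
  - intros q; pose proof (proj1 (proj2_sig q)) as C.
    etransitivity; [apply (f_equal (fun r => coset_mul Ha r _)), (pi_proj Ha q) |].
    unfold coset_inv; rewrite (coset_mul_pi Ha _ _ _ _ (commute_mul _ _ _ C (commute_inv _ _ C))).
    apply pi_eq; rewrite gmulVr; auto.
Defined.

Lemma pi_mul {G : Group} {a : G} (Ha : a ** a = gone G) (x y : G)
    (H : commute a x) (H' : commute a y) :
  gmul (quotient Ha) (pi Ha x H) (pi Ha y H') = pi Ha (x ** y) (commute_mul _ _ _ H H').
Proof. apply coset_mul_pi. Qed.

Lemma pi_inv {G : Group} {a : G} (Ha : a ** a = gone G) (x : G) (H : commute a x) :
  ginv (quotient Ha) (pi Ha x H) = pi Ha (ginv G x) (commute_inv _ _ H).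
Proof.
  symmetry; apply (ginv_unique (G := quotient Ha)).
  rewrite pi_mul; apply pi_eq; rewrite gmulVr; auto.
Qed.

Lemma pi_pow {G : Group} {a : G} (Ha : a ** a = gone G) (x : G) (H : commute a x) (n : nat) :
  gpow (quotient Ha) (pi Ha x H) n = pi Ha (gpow G x n) (commute_pow _ _ n H).
Proof.
  induction n as [| n IH]; simpl.
  - apply pi_eq; auto.
  - rewrite IH; etransitivity; [apply pi_mul | apply pi_eq; auto].
Qed.

(** Correspondence theorem: taking preimages embeds the subgroup graph of the quotient into that of
    [G]. *)
Lemma quotient_planar {G : Group} {a : G} (Ha : a ** a = gone G) :
  planar_group G -> planar_group (quotient Ha).
Proof.
  assert (S : forall L : subgroup (quotient Ha),
    is_subgroup G (fun x => exists H : commute a x, sgset L (pi Ha x H))).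
  { intros [L (L1 & Lm & Li)]; simpl; split; [| split].
    - exists (commute_one a); exact L1.
    - intros x y (H & Hx) (H' & Hy); exists (commute_mul _ _ _ H H').
      rewrite <- pi_mul; auto.
    - intros x (H & Hx); exists (commute_inv _ _ H).
      rewrite <- pi_inv; auto. }
  pose (F := fun L => exist (is_subgroup G) _ (S L)).
  assert (HF : forall L x (H : commute a x), sgset (F L) x <-> sgset L (pi Ha x H)).
  { intros L x H; simpl; split; [| eauto].
    intros (H' & K); rewrite (proof_irrelevance _ H H'); trivial. }
  assert (HF' : forall L L', (forall x, sgset (F L) x -> sgset (F L') x) <->
                             (forall q, sgset L q -> sgset L' q)).
  { intros L L'; split.
    - intros K q; rewrite (pi_proj Ha q), <- !HF; apply K.
    - intros K x (H & Hx); exists H; auto. }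
  assert (Fmax : forall L L', maximal_in L L' -> maximal_in (F L) (F L')).
  { intros L L' (H1 & (q & Hq & Nq) & H3); split; [apply HF'; trivial |]; split.
    - exists (proj1_sig q).
      rewrite !(HF _ _ (proj1 (proj2_sig q))), <- !pi_proj; auto.
    - intros M HM HM'.
      assert (SM : is_subgroup (quotient Ha)
        (fun q => exists x (H : commute a x), sgset M x /\ q = pi Ha x H)).
      { destruct M as [M (M1 & Mm & Mi)]; simpl; split; [| split].
        - exists (gone G), (commute_one a); auto.
        - intros s t (x & H & Hx & ->) (y & H' & Hy & ->).
          exists (x ** y), (commute_mul _ _ _ H H'); rewrite pi_mul; auto.
        - intros s (x & H & Hx & ->); exists (ginv G x), (commute_inv _ _ H); rewrite pi_inv; auto. }
      (* Since [M] contains [a], it is a union of cosets, hence the preimage of its image. *)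
      assert (Ma : sgset M a).
      { apply HM; exists (eq_refl : commute a a).
        replace (pi Ha a eq_refl) with (gone (quotient Ha)); [apply (proj2_sig L) |].
        apply pi_eq; right; auto. }
      assert (HMF : forall x, sgset M x <-> sgset (F (exist _ _ SM)) x).
      { intros x; split.
        - intros Hx; destruct (HM' x Hx) as (H & _); exists H; simpl; eauto.
        - intros (H & y & H' & Hy & E); apply pi_inj in E.
          destruct E as [-> | ->]; [trivial |]; apply (proj2_sig M); trivial. }
      destruct (H3 (exist _ _ SM)) as [K | K].
      + apply HF'; intros x; rewrite <- HMF; auto.
      + apply HF'; intros x; rewrite <- HMF; auto.
      + left; intros x; rewrite HMF; split; apply HF'; apply K.
      + right; intros x; rewrite HMF; split; apply HF'; apply K. }
  apply (planar_pullback _ _ F).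
  - intros L L' E; apply subgroup_ext; intros q; split; revert q; apply HF'; rewrite E; auto.
  - intros L L' [H | H]; [left | right]; apply Fmax; trivial.
Qed.

(** * Infinite planar 2-groups *)

(** A form of the 2-group condition that passes to quotients at once, although orders may drop
    there. *)
Definition two_power (G : Group) : Prop := forall x : G, exists k, gpow G x (2 ^ k) = gone G.

Lemma quotient_two_power {G : Group} {a : G} (Ha : a ** a = gone G) :
  two_power G -> two_power (quotient Ha).
Proof.
  intros HG q; destruct (pi_surj Ha q) as (x & H & ->), (HG x) as [k Hk].
  exists k; rewrite pi_pow; apply pi_eq; auto.
Qed.

(** Repeated squaring halves the order of [x] until it is exactly [2^(m+1)]. *)
Lemma high_order_power {G : Group} (x : G) (m : nat) :
  two_power G -> gpow G x (2 ^ m) <> gone G ->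
  exists j, gpow G (gpow G x j) (2 ^ S m) = gone G /\ gpow G (gpow G x j) (2 ^ m) <> gone G.
Proof.
  intros HG N; destruct (HG x) as [k Hk]; revert x Hk N.
  induction k as [| k IH]; intros x Hk N.
  - exfalso; apply N; simpl in Hk; rewrite gmul1r in Hk; rewrite Hk; apply gpow_one.
  - destruct (classic (gpow G x (2 ^ S m) = gone G)) as [K | K].
    + exists 1; rewrite gpow_1; auto.
    + destruct (IH (gpow G x 2)) as [j Hj].
      * rewrite <- gpow_mul; trivial.
      * rewrite <- gpow_mul; trivial.
      * exists (2 * j); rewrite gpow_mul; trivial.
Qed.

(** Conjugation by [u] inverts every power of [u v]; a power of order 8 would contradict
    [planar_D16]. *)
Lemma involutions_product {G : Group} (u v : G) :
  planar_group G -> two_power G -> u ** u = gone G -> v ** v = gone G ->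
  gpow G (u ** v) 4 = gone G.
Proof.
  intros HP HG Hu Hv; apply NNPP; intros N.
  destruct (high_order_power (u ** v) 2 HG N) as (j & H8 & H4); apply H4.
  apply (planar_D16 _ u); trivial.
  apply ginv_unique; clear N H8 H4; induction j as [| j IH]; simpl.
  - rewrite gmul1l, gmul1r; trivial.
  - assert (C : gpow G (u ** v) j ** (u ** v) = u ** v ** gpow G (u ** v) j)
      by (apply commute_sym, commute_pow; unfold commute; trivial).
    assert (E : u ** v ** u ** (u ** v) = u).
    { rewrite !gmulA, <- (gmulA G _ u u), Hu, gmul1r, <- gmulA, Hv, gmul1r; trivial. }
    set (r := gpow G (u ** v) j) in *; rewrite <- C at 1.
    transitivity (r ** ((u ** v ** u ** (u ** v)) ** r ** u)).
    + rewrite !gmulA; trivial.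
    + rewrite E; trivial.
Qed.

(** As [(u v)^4 = 1], the square of [u v] equals its inverse, the square of [v u]; conjugation by
    [u] or [v] exchanges the two. *)
Lemma involutions_commutator {G : Group} (u v : G) :
  u ** u = gone G -> v ** v = gone G -> gpow G (u ** v) 4 = gone G ->
  commute u (u ** v ** (u ** v)) /\ commute v (u ** v ** (u ** v)).
Proof.
  intros Hu Hv H; rewrite gpow_4 in H; set (d := u ** v ** (u ** v)) in *.
  assert (E : d = v ** u ** (v ** u)).
  { rewrite (ginv_unique _ _ H); symmetry; apply ginv_unique; unfold d.
    rewrite !gmulA, <- (gmulA G _ v v), Hv, gmul1r, <- (gmulA G _ u u), Hu, gmul1r.
    rewrite <- (gmulA G _ v v), Hv, gmul1r; trivial. }
  split; unfold commute.
  - rewrite E at 1; unfold d; rewrite !gmulA; trivial.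
  - rewrite E at 2; unfold d; rewrite !gmulA; trivial.
Qed.

Lemma commute_of_square {G : Group} (u v : G) :
  u ** u = gone G -> v ** v = gone G -> u ** v ** (u ** v) = gone G -> commute u v.
Proof.
  intros Hu Hv H; unfold commute.
  rewrite (ginv_unique _ _ H); symmetry; apply ginv_unique.
  rewrite !gmulA, <- (gmulA G _ v v), Hv, gmul1r; trivial.
Qed.

(** Otherwise [a] and [d = (b c)^2] are distinct commuting involutions that commute with [b], so [b]
    lies in [<a, d>] and commutes with [c], whence [d = 1]. *)
Lemma commutator_in_center {G : Group} (a b c : G) :
  planar_group G -> two_power G ->
  a ** a = gone G -> b ** b = gone G -> c ** c = gone G -> a <> gone G ->
  commute a b -> commute a c ->
  b ** c ** (b ** c) = gone G \/ b ** c ** (b ** c) = a.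
Proof.
  intros HP HG Ha Hb Hc Na Hab Hac; apply NNPP; intros N; apply not_or_and in N as [N N'].
  pose proof (involutions_product b c HP HG Hb Hc) as H4.
  destruct (involutions_commutator b c Hb Hc H4) as [Cb Cc]; rewrite gpow_4 in H4.
  set (d := b ** c ** (b ** c)) in *.
  enough (Hbc : commute b c).
  { apply N; unfold d; rewrite gmul_swap, Hb, Hc, gmul1l; auto using commute_sym. }
  assert (Had : commute a d) by (repeat apply commute_mul; trivial).
  apply commute_sym.
  destruct (planar_C2C2C2 a d b) as [E | [E | [E | E]]]; auto using commute_sym; rewrite E.
  - apply commute_one.
  - apply commute_sym; trivial.
  - trivial.
  - apply commute_mul; auto using commute_sym.
Qed.

Definition finite_pred {A : Type} (P : A -> Prop) : Prop :=
  exists l, forall x, P x -> In x l.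

Lemma finite_impl {A : Type} (P Q : A -> Prop) :
  (forall x, P x -> Q x) -> finite_pred Q -> finite_pred P.
Proof. intros H [l Hl]; exists l; auto. Qed.

Lemma finite_union {A B : Type} (P : A -> B -> Prop) (l : list A) :
  (forall y, In y l -> finite_pred (P y)) -> finite_pred (fun x => exists y, In y l /\ P y x).
Proof.
  induction l as [| y l IH]; intros H.
  - exists []; intros x (y & [] & _).
  - destruct (H y (or_introl eq_refl)) as [m Hm].
    destruct IH as [m' Hm']; [intros z Hz; apply H; right; trivial |].
    exists (m ++ m'); intros x (z & [<- | Hz] & K); apply in_or_app; [auto | right; eauto].
Qed.

(* Modulo [a] the involutions commuting with [a] commute pairwise, so there are at
   most three non-trivial ones by [planar_C2C2C2]. *)
Lemma finite_commuting_involutions {G : Group} (a : G) :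
  planar_group G -> two_power G -> a ** a = gone G -> a <> gone G ->
  finite_pred (fun x => x ** x = gone G /\ commute a x).
Proof.
  intros HP HG Ha Na.
  destruct (classic (exists b, (b ** b = gone G /\ commute a b) /\ ~ In b [gone G; a]))
    as [(b & [Hb Hab] & Nb) | N].
  2: exists [gone G; a]; intros x Hx; apply NNPP; intros K; apply N; eauto.
  destruct (classic (exists c, (c ** c = gone G /\ commute a c) /\
    ~ In c [gone G; a; b; b ** a])) as [(c & [Hc Hac] & Nc) | N].
  2: exists [gone G; a; b; b ** a]; intros x Hx; apply NNPP; intros K; apply N; eauto.
  (* With [b] and [c] independent modulo [a], these are the elements of the cosets of 1, [b], [c]
     and [b c]. *)
  exists [gone G; a; b; b ** a; c; c ** a; b ** c; b ** c ** a].
  intros x [Hx Hax].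
  assert (Hcomm : forall y z (H : commute a y) (H' : commute a z),
    y ** y = gone G -> z ** z = gone G -> @commute (quotient Ha) (pi Ha y H) (pi Ha z H')).
  { intros y z H H' Hy Hz; unfold commute; rewrite !pi_mul; apply pi_eq.
    assert (K : z ** y ** (z ** y) = gone G \/ z ** y ** (z ** y) = a)
      by (apply commutator_in_center; trivial).
    assert (E : y ** z = (z ** y) ** (z ** y ** (z ** y))).
    { apply (gmul_cancel_l (z ** y)).
      rewrite gmulA, <- (gmulA G z y y), Hy, gmul1r, Hz.
      rewrite gmulA, <- gpow_4; symmetry; apply involutions_product; trivial. }
    rewrite E; destruct K as [-> | ->]; [left; apply gmul1r | auto]. }
  assert (Hsq : forall y (H : commute a y), y ** y = gone G ->
    gmul (quotient Ha) (pi Ha y H) (pi Ha y H) = gone (quotient Ha)).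
  { intros y H Hy; rewrite pi_mul; apply pi_eq; auto. }
  assert (Hne : forall y (H : commute a y), ~ In y [gone G; a] ->
    pi Ha y H <> gone (quotient Ha)).
  { intros y H Ny E; apply pi_inj in E; rewrite gmul1l in E; apply Ny.
    destruct E as [-> | ->]; simpl; auto. }
  destruct (planar_C2C2C2 (G := quotient Ha) (pi Ha b Hab) (pi Ha c Hac) (pi Ha x Hax))
    as [E | [E | [E | E]]]; auto using quotient_planar.
  - apply Hne; intros K; apply Nc; simpl in *; tauto.
  - intros E; symmetry in E; apply pi_inj in E; apply Nc.
    destruct E as [-> | ->]; simpl; auto.
  - apply pi_inj in E; rewrite gmul1l in E; destruct E as [-> | ->]; simpl; auto.
  - apply pi_inj in E; destruct E as [-> | ->]; simpl; auto.
  - apply pi_inj in E; destruct E as [-> | ->]; simpl; auto 10.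
  - rewrite pi_mul in E; apply pi_inj in E; destruct E as [-> | ->]; simpl; auto 10.
Qed.

Lemma finite_involutions {G : Group} :
  planar_group G -> two_power G -> finite_pred (fun x : G => x ** x = gone G).
Proof.
  intros HP HG.
  destruct (classic (exists a : G, a ** a = gone G /\ a <> gone G)) as [(a & Ha & Na) | N].
  2: exists [gone G]; intros x Hx; left; apply NNPP; intros K; apply N; exists x; auto.
  destruct (finite_commuting_involutions a HP HG Ha Na) as [l Hl].
  apply finite_impl with (Q := fun x => exists d, In d l /\
    (d ** d = gone G /\ d <> gone G /\ x ** x = gone G /\ commute d x)).
  - intros x Hx; destruct (classic (commute a x)) as [C | C].
    + exists a; split; [apply Hl; split; unfold commute |]; auto.
    + pose proof (involutions_product a x HP HG Ha Hx) as H4.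
      destruct (involutions_commutator a x Ha Hx H4) as [Ca Cx]; rewrite gpow_4 in H4.
      (* The square of [a x] is an involution commuting with both [a] and [x], so it belongs to the
         finite list [l]. *)
      exists (a ** x ** (a ** x)); repeat split; auto using commute_sym.
      intros E; apply C, commute_of_square; trivial.
  - apply finite_union; intros d _.
    destruct (classic (d ** d = gone G /\ d <> gone G)) as [[Hd Nd] | K].
    + apply finite_impl with (Q := fun x => x ** x = gone G /\ commute d x); [tauto |].
      apply finite_commuting_involutions; trivial.
    + exists []; intros x Hx; tauto.
Qed.

(** The power [a = x^(2^n)] is one of finitely many elements of square 1, and [x] commutes with it.
    The image of [x] modulo [a] has exponent [2^n], so induction applies to the quotient, each
    element of which has at most two preimages. If [a = 1], the quotient is a copy of [G]. *)
Lemma finite_exponent (n : nat) : forall G : Group,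
  planar_group G -> two_power G -> finite_pred (fun x : G => gpow G x (2 ^ n) = gone G).
Proof.
  induction n as [| n IH]; intros G HP HG.
  - exists [gone G]; intros x Hx; left; symmetry; rewrite <- (gpow_1 x); exact Hx.
  - destruct (finite_involutions HP HG) as [l Hl].
    apply finite_impl with (Q := fun x => exists a, In a l /\
      (a ** a = gone G /\ gpow G x (2 ^ n) = a)).
    + intros x Hx; exists (gpow G x (2 ^ n)).
      assert (E : gpow G x (2 ^ n) ** gpow G x (2 ^ n) = gone G).
      { rewrite <- gpow_add, <- Hx; f_equal; simpl; lia. }
      auto.
    + apply finite_union; intros a _.
      destruct (classic (a ** a = gone G)) as [Ha | N]; [| exists []; tauto].
      destruct (IH (quotient Ha)) as [m Hm];
        [apply quotient_planar | apply quotient_two_power |]; trivial.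
      exists (flat_map (fun q : coset a => [proj1_sig q; proj1_sig q ** a]) m).
      intros x [_ Hx].
      assert (H : commute a x)
        by (rewrite <- Hx; apply commute_sym, commute_pow; unfold commute; trivial).
      apply in_flat_map; exists (pi Ha x H); split.
      * apply Hm; rewrite pi_pow; apply pi_eq; rewrite gmul1l; auto.
      * simpl; destruct (rep_cases a x) as [-> | ->]; [auto |].
        rewrite <- gmulA, Ha, gmul1r; auto.
Qed.

(** The conjugates of [x] satisfy the same power equation, so they are finitely many, and [P] is
    covered by finitely many cosets of the centralizer of [x] in [P]. A general [P] allows
    centralizers to be taken successively. *)
Lemma finite_of_centralizer {G : Group} (x : G) (P : G -> Prop) :
  planar_group G -> two_power G -> is_subgroup G P ->
  finite_pred (fun g => P g /\ commute x g) -> finite_pred P.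
Proof.
  intros HP HG (_ & Pm & Pi) [m Hm].
  destruct (HG x) as [n Hn], (finite_exponent n G HP HG) as [l Hl].
  assert (Hconj : forall g k, gpow G (g ** x ** ginv G g) k = g ** gpow G x k ** ginv G g).
  { intros g; induction k as [| k IH]; simpl; [rewrite gmul1r, gmulVr; trivial |].
    rewrite IH, <- !gmulA, (gmulA G (ginv G g) g), gmulVl, gmul1l; trivial. }
  apply finite_impl with (Q := fun g => exists z, In z l /\ (P g /\ g ** x ** ginv G g = z)).
  - intros g Hg; exists (g ** x ** ginv G g); repeat split; trivial.
    apply Hl; rewrite Hconj, Hn, gmul1r, gmulVr; trivial.
  - apply finite_union; intros z _.
    destruct (classic (exists g, P g /\ g ** x ** ginv G g = z)) as [(g & Hg & Ez) | N].
    2: exists []; intros g Hg; apply N; eauto.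
    exists (map (gmul G g) m); intros h [Hh E].
    replace h with (g ** (ginv G g ** h)) by (rewrite gmulA, gmulVr, gmul1l; trivial).
    apply in_map, Hm; split; [auto |].
    unfold commute; apply (gmul_cancel_l g), (gmul_cancel_r (ginv G h)).
    rewrite !gmulA, gmulVr, gmul1l, E, <- Ez.
    rewrite <- !gmulA, gmulVr, gmul1r; trivial.
Qed.

(** Induction on the squares of [x] and [c] gives [w = x c^j] with [w^4 = 1]. If [w^2] is not 1,
    take [d] of order 4 in [<c>]: [planar_C4C4] gives [w^2 = d^2], so [w d] has square [d^4 = 1]. *)
Lemma involution_translate {G : Group} (n : nat) : forall x c : G,
  planar_group G -> two_power G -> commute x c ->
  gpow G x (2 ^ n) = gone G -> gpow G c (2 ^ S n) <> gone G ->
  exists j, (x ** gpow G c j) ** (x ** gpow G c j) = gone G.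
Proof.
  induction n as [| n IH]; intros x c HP HG Hxc Hx Hc.
  - exists 0; rewrite gpow_0, gmul1r, <- (gpow_1 x); change 1 with (2 ^ 0); rewrite Hx.
    apply gmul1l.
  - assert (Hxc2 : forall i j, commute (gpow G x i) (gpow G c j))
      by (intros i j; apply commute_pows; trivial).
    destruct (IH (gpow G x 2) (gpow G c 2)) as [j Hj]; trivial.
    { rewrite <- gpow_mul; trivial. }
    { rewrite <- gpow_mul; trivial. }
    set (w := x ** gpow G c j).
    assert (Cw : forall i, commute w (gpow G c i)).
    { intros i; apply commute_sym, commute_mul; [| apply commute_pow_self].
      apply commute_sym; rewrite <- (gpow_1 x); trivial. }
    assert (Ew : w ** w = gpow G x 2 ** gpow G (gpow G c 2) j).
    { unfold w; rewrite gmul_swap, gpow_2, <- gpow_add, <- gpow_mul; [do 2 f_equal; lia |].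
      apply commute_sym; rewrite <- (gpow_1 x); trivial. }
    rewrite <- Ew in Hj.
    destruct (classic (w ** w = gone G)) as [E | Nw]; [exists j; trivial |].
    destruct (high_order_power c 1 HG) as (i & Hi4 & Hi2).
    { intros K; apply Hc; change (2 ^ S (S n)) with (2 * 2 ^ S n).
      change (2 ^ 1) with 2 in K; rewrite gpow_mul, K, gpow_one; trivial. }
    set (d := gpow G c i) in *.
    change (2 ^ 1) with 2 in Hi2; rewrite gpow_2 in Hi2; change (2 ^ 2) with 4 in Hi4.
    assert (E : w ** w = d ** d) by (apply planar_C4C4; rewrite ?(gpow_4 w); trivial; apply Cw).
    exists (j + i); rewrite gpow_add, (gmulA G x); fold w d.
    rewrite (gmul_swap w d w d), E, <- gpow_4 by apply commute_sym, Cw; trivial.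
Qed.

Lemma commute_of_central_order_four {G : Group} (u v d : G) :
  planar_group G -> two_power G -> u ** u = gone G -> v ** v = gone G ->
  commute d u -> commute d v -> gpow G d 4 = gone G -> d ** d <> gone G ->
  commute u v.
Proof.
  intros HP HG Hu Hv Hdu Hdv Hd4 Hd2; apply NNPP; intros N.
  pose proof (involutions_product u v HP HG Hu Hv) as H4.
  destruct (involutions_commutator u v Hu Hv H4) as [Cu Cv]; rewrite gpow_4 in H4, Hd4.
  assert (Nz : u ** v ** (u ** v) <> gone G) by (intros E; apply N, commute_of_square; trivial).
  assert (Cz : commute d (u ** v ** (u ** v))) by (repeat apply commute_mul; trivial).
  set (z := u ** v ** (u ** v)) in *.
  assert (Cud : commute u (d ** d)) by (apply commute_mul; apply commute_sym; trivial).
  assert (Cvd : commute v (d ** d)) by (apply commute_mul; apply commute_sym; trivial).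
  (* Otherwise [u] would lie in the four-group generated by [d^2] and [z], which commutes with
     [v]. *)
  assert (E : d ** d = z).
  { apply NNPP; intros K; apply N, commute_sym.
    destruct (planar_C2C2C2 (d ** d) z u) as [E | [E | [E | E]]];
      auto using commute_sym; rewrite ?E; try solve [auto using commute_one, commute_mul].
    apply commute_sym, commute_mul; apply commute_sym; trivial. }
  pose proof (commute_sym _ _ Cu) as Cu'; pose proof (commute_sym _ _ Cv) as Cv'.
  pose proof (commute_sym _ _ Cz) as Cz'.
  assert (Euv : u ** v = v ** u ** z).
  { unfold z; rewrite !gmulA, <- (gmulA G _ u u), Hu, gmul1r, Hv, gmul1l; trivial. }
  (* Modulo [z], [u] agrees with nothing that commutes with [v], while whatever agrees with [d]
     commutes with both [u] and [v]. This makes the images of [u], [v] and [d] independent. *)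
  assert (Nvz : forall y, commute v y -> ~ (u = y \/ u = y ** z)).
  { intros y Hy [E' | E']; apply N; rewrite E'; apply commute_sym; trivial.
    apply commute_mul; trivial. }
  assert (Ndz : forall y, d = y \/ d = y ** z -> commute u y /\ commute v y).
  { intros y Hy.
    assert (W : forall w, commute w z -> commute w d -> commute w y).
    { intros w Hw Hdw; destruct Hy as [<- | Hy]; [trivial |].
      rewrite Hy in Hdw; apply commute_mul_r_iff with (z := z); trivial. }
    split; apply W; auto using commute_sym. }
  destruct (planar_C2C2C2 (G := quotient H4) (pi H4 u Cu') (pi H4 v Cv') (pi H4 d Cz'))
    as [K | [K | [K | K]]].
  - apply quotient_planar; trivial.
  - unfold commute; rewrite !pi_mul; apply pi_eq; auto.
  - unfold commute; rewrite !pi_mul; apply pi_eq; auto.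
  - unfold commute; rewrite !pi_mul; apply pi_eq; auto.
  - rewrite pi_mul; apply pi_eq; auto.
  - rewrite pi_mul; apply pi_eq; auto.
  - rewrite pi_mul; apply pi_eq; right; rewrite gmul1l; trivial.
  - intros K; apply pi_inj in K; revert K; apply Nvz, commute_one.
  - intros K; apply pi_inj in K; apply N; rewrite gmul1l in K.
    destruct K as [K | K]; rewrite K; [apply commute_one | trivial].
  - intros K; apply pi_inj in K; revert K; apply Nvz; unfold commute; trivial.
  - apply pi_inj in K; apply Hd2; rewrite gmul1l in K; destruct K as [-> | ->];
      [apply gmul1l | trivial].
  - apply pi_inj, Ndz in K; apply N, commute_sym, K.
  - apply pi_inj, Ndz in K; apply N, K.
  - rewrite pi_mul in K; apply pi_inj, Ndz in K as [K _]; apply N.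
    apply (gmul_cancel_l u); unfold commute in K; rewrite K, gmulA; trivial.
Qed.

Theorem theorem3p13 (G : Group) :
  infinite_group G -> two_group G -> planar_group G -> abelian G.
Proof.
  intros Hinf H2 HP x y; apply NNPP; intros N.
  assert (HG : two_power G) by (intros z; destruct (H2 z) as (k & _ & E & _); eauto).
  destruct (HG x) as [m Hm], (HG y) as [n Hn].
  (* A common exponent for [x] and [y] lets a single [c] serve both. *)
  assert (Hx : gpow G x (2 ^ (m + n)) = gone G)
    by (rewrite Nat.pow_add_r, gpow_mul, Hm; apply gpow_one).
  assert (Hy : gpow G y (2 ^ (m + n)) = gone G)
    by (rewrite Nat.pow_add_r, Nat.mul_comm, gpow_mul, Hn; apply gpow_one).
  (* Otherwise the common centralizer of [x] and [y] has bounded exponent, so it is finite; then so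
     are the centralizer of [x] and [G] itself. *)
  assert (exists c, commute x c /\ commute y c /\ gpow G c (2 ^ S (m + n)) <> gone G)
    as (c & Cx & Cy & Hc).
  { apply NNPP; intros K; apply Hinf.
    assert (F : finite_pred (fun _ : G => True)); [| destruct F as [l Hl]; exists l; auto].
    apply (finite_of_centralizer x); trivial; [repeat split |].
    apply (finite_of_centralizer y); trivial.
    - split; [| split].
      + split; [trivial | apply commute_one].
      + intros g h [_ Hg] [_ Hh]; split; [trivial | apply commute_mul; trivial].
      + intros g [_ Hg]; split; [trivial | apply commute_inv; trivial].
    - apply finite_impl with (2 := finite_exponent (S (m + n)) G HP HG).
      intros c [[_ Cx] Cy]; apply NNPP; intros Hc; apply K; exists c; auto. }
  destruct (involution_translate (m + n) x c) as [i Hi]; trivial.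
  destruct (involution_translate (m + n) y c) as [j Hj]; trivial.
  destruct (high_order_power c 1 HG) as (k & Hk4 & Hk2).
  { intros K; apply Hc; change (2 ^ S (m + n)) with (2 * 2 ^ (m + n)).
    change (2 ^ 1) with 2 in K; rewrite gpow_mul, K, gpow_one; trivial. }
  assert (Cd : forall z l, commute z c -> commute (gpow G c k) (z ** gpow G c l)).
  { intros z l C; apply commute_mul; [| apply commute_pow_self].
    apply commute_sym, commute_pow, C. }
  assert (C : commute (x ** gpow G c i) (y ** gpow G c j)).
  { apply (commute_of_central_order_four _ _ (gpow G c k)); auto.
    rewrite <- gpow_2; exact Hk2. }
  (* Powers of [c] commute with [x] and [y], so they can be cancelled from [C] one side at a
     time. *)
  apply N.
  assert (Cyx : commute (y ** gpow G c j) x).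
  { apply commute_mul_r_iff with (z := gpow G c i); [| exact (commute_sym _ _ C)].
    apply commute_sym, commute_mul; [| apply commute_pow_self].
    apply commute_sym, commute_pow, Cy. }
  apply (commute_mul_r_iff x y (gpow G c j)); [| apply commute_sym, Cyx].
  apply commute_pow, Cx.
Qed.
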